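(* Let $K$ be a finite Galois extension of $\mathbb{Q}$ which is unramified at $2$, with ring of integers $R$ and Galois group $G$, and let $M$ be a countable right $R[\mathbb{Z}/2\mathbb{Z}]$-module which is projective as an $R$-module. Then there is an $R[\mathbb{Z}/2\mathbb{Z}]$-linear isomorphism $M[G]\oplus R[\mathbb{Z}/2\mathbb{Z}]^{\oplus\infty}\cong P_+\oplus P_-\oplus R[\mathbb{Z}/2\mathbb{Z}]^{\oplus\infty}$ for some countable right $R[\mathbb{Z}/2\mathbb{Z}]$-modules $P_+,P_-$ which are projective as $R$-modules and on which $Y\in R[\mathbb{Z}/2\mathbb{Z}]$ acts by the scalars $+1$ and $-1$, respectively.
   Context: $R[\mathbb{Z}/2\mathbb{Z}]=R[Y]/(Y^2-1)$; $G$ acts on $R$ by ring automorphisms and on $R[\mathbb{Z}/2\mathbb{Z}]$ with $g(Y)=Y$. For a right $R[\mathbb{Z}/2\mathbb{Z}]$-module $M$ and $g\in G$, $M[g]$ is the abelian group $M$ (elements written $x[g]$) with right action $(x[g])a=(x\,g(a))[g]$; $M[G]:=\bigoplus_{g\in G}M[g]$. $X^{\oplus\infty}$ denotes the direct sum of countably infinitely many copies. ''Unramified at $2$'' means $2R=\mathfrak{p}_1\cdots\mathfrak{p}_n$ for mutually distinct prime ideals $\mathfrak{p}_i$. *)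

(* Defs.v *)
From HB Require Import structures.
From mathcomp Require Import all_boot all_order all_algebra all_fingroup all_field.

Set Implicit Arguments.
Unset Strict Implicit.
Unset Printing Implicit Defensive.

Import GRing.Theory Num.Theory.
Local Open Scope ring_scope.

(* The group ring R[Z/2Z] := R[Y]/(Y^2 - 1), realised with MathComp's       *)
(* quotient polynomial ring {poly %/ h}; the class of Y is 'qX.             *)
Notation RZ2 R := {poly %/ ('X^2 - 1 : {poly R})}.

Definition YZ2 (R : comNzRingType) : RZ2 R := 'qX.

Section Twist.
Variables (R : comNzRingType) (s : {rmorphism R -> R}).

Definition twistZ2 (x : RZ2 R) : RZ2 R := in_qpoly _ (map_poly s (x : {poly R})).

Let m := mk_monic ('X^2 - 1 : {poly R}).

Let mon_m : m \is monic. Proof. exact: monic_mk_monic. Qed.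

Let map_m : map_poly s m = m.
Proof.
rewrite /m /mk_monic; case: ifP => _.
  by rewrite rmorphB /= map_polyXn rmorph1.
exact: map_polyX.
Qed.

Let in_qpoly_modE (p : {poly R}) :
  in_qpoly ('X^2 - 1) (map_poly s (Pdiv.Ring.rmodp p m))
  = in_qpoly ('X^2 - 1) (map_poly s p).
Proof.
rewrite {2}(Pdiv.RingMonic.rdivp_eq mon_m p) rmorphD rmorphM /= map_m.
rewrite [in RHS]rmorphD [in RHS]rmorphM /=.
have -> : in_qpoly ('X^2 - 1 : {poly R}) m = 0.
  by apply: val_inj; rewrite /= Pdiv.RingMonic.rmodpp.
by rewrite mulr0 add0r.
Qed.

Lemma twistZ2_is_zmod : zmod_morphism twistZ2.
Proof. by move=> x y; rewrite /twistZ2 /= !rmorphB. Qed.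

Lemma twistZ2_is_monoid : monoid_morphism twistZ2.
Proof.
split; first by rewrite /twistZ2 /= rmorph1 rmorph1.
move=> x y; rewrite /twistZ2 /=.
rewrite in_qpoly_modE rmorphM /= rmorphM //.
Qed.

HB.instance Definition _ := GRing.isZmodMorphism.Build _ _ twistZ2 twistZ2_is_zmod.
HB.instance Definition _ := GRing.isMonoidMorphism.Build _ _ twistZ2 twistZ2_is_monoid.
End Twist.

Section Restriction.
Variables (R : comNzRingType) (M : lmodType (RZ2 R)).

Definition resR : Type := M.
HB.instance Definition _ := GRing.Zmodule.on resR.

Definition res_scale (a : R) (x : resR) : resR := ((a%:A : RZ2 R) *: (x : M) : M).

Fact res_scaleA a b v : res_scale a (res_scale b v) = res_scale (a * b) v.
Proof. by rewrite /res_scale scalerA -scalerAl mul1r scalerA. Qed.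
Fact res_scale1 : left_id 1 res_scale.
Proof. by move=> v; rewrite /res_scale scale1r scale1r. Qed.
Fact res_scaleDr : right_distributive res_scale +%R.
Proof. by move=> a u v; rewrite /res_scale scalerDr. Qed.
Fact res_scaleDl v : {morph res_scale^~ v : a b / a + b}.
Proof. by move=> a b; rewrite /res_scale scalerDl scalerDl. Qed.

HB.instance Definition _ := GRing.Zmodule_isLmodule.Build R resR
  res_scaleA res_scale1 res_scaleDr res_scaleDl.
End Restriction.

(* M[I] := (+)_{i in I} M[s_i] : the finite direct sum of the twisted       *)
(* modules M[s_i], where (x[s])a = (x s(a))[s] (written as a left action,   *)
(* R[Z/2Z] being commutative).                                               *)
Section TwistedSum.
Variables (R : comNzRingType) (I : finType) (sg : I -> {rmorphism R -> R}).
Variable (M : lmodType (RZ2 R)).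

Definition twsum_of (s : I -> {rmorphism R -> R}) : Type := {ffun I -> M}.
Local Notation twsum := (twsum_of sg).
HB.instance Definition _ := GRing.Zmodule.on twsum.

Definition tw_scale (a : RZ2 R) (f : twsum) : twsum :=
  [ffun i => twistZ2 (sg i) a *: f i].

Fact tw_scaleA a b v : tw_scale a (tw_scale b v) = tw_scale (a * b) v.
Proof. by apply/ffunP => i; rewrite !ffunE scalerA rmorphM. Qed.
Fact tw_scale1 : left_id 1 tw_scale.
Proof. by move=> v; apply/ffunP => i; rewrite !ffunE rmorph1 scale1r. Qed.
Fact tw_scaleDr : right_distributive tw_scale +%R.
Proof. by move=> a u v; apply/ffunP => i; rewrite !ffunE scalerDr. Qed.
Fact tw_scaleDl v : {morph tw_scale^~ v : a b / a + b}.
Proof. by move=> a b; apply/ffunP => i; rewrite !ffunE rmorphD scalerDl. Qed.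

HB.instance Definition _ := GRing.Zmodule_isLmodule.Build (RZ2 R) twsum
  tw_scaleA tw_scale1 tw_scaleDr tw_scaleDl.
End TwistedSum.

Notation twsum sg M := (@twsum_of _ _ M sg).

(* A^{(+)oo}: the direct sum of countably many copies of A, i.e. the        *)
(* finitely supported sequences N -> A; realised as {poly A} (the sequence  *)
(* of coefficients), with its A-module structure.                           *)
Definition dsum_inf (A : comNzRingType) : Type := {poly A}.
HB.instance Definition _ (A : comNzRingType) := GRing.Lmodule.on (dsum_inf A).

Definition mod_iso (A : comNzRingType) (U V : lmodType A) : Prop :=
  exists f : {linear U -> V}, bijective f.

Definition projective (A : comNzRingType) (P : lmodType A) : Prop :=
  forall (U V : lmodType A) (p : {linear U -> V}) (f : {linear P -> V}),
    (forall v, exists u, p u = v) ->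
    exists g : {linear P -> U}, forall x, p (g x) = f x.

Definition countable_type (T : Type) : Prop := exists f : T -> nat, injective f.

Section Ideals.
Variable R : comNzRingType.

Definition is_ideal (I : R -> Prop) : Prop :=
  [/\ I 0, (forall x y, I x -> I y -> I (x - y)) & (forall a x, I x -> I (a * x))].

Definition is_prime_ideal (I : R -> Prop) : Prop :=
  [/\ is_ideal I, ~ I 1 & (forall a b, I (a * b) -> I a \/ I b)].

Definition ideal_mul (I J : R -> Prop) : R -> Prop :=
  fun x => exists n (a b : 'I_n -> R),
    [/\ forall i, I (a i), forall i, J (b i) & x = \sum_(i < n) a i * b i].

Definition ideal_prod n (p : 'I_n -> R -> Prop) : R -> Prop :=
  foldr (fun i J => ideal_mul (p i) J) (fun _ => True) (enum 'I_n).

Definition principal_ideal (c : R) : R -> Prop := fun x => exists a, x = a * c.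

Definition unramified_at_2 : Prop :=
  exists n (p : 'I_n -> R -> Prop),
    [/\ forall i, is_prime_ideal (p i),
        forall i j, i != j -> ~ (forall x, p i x <-> p j x) &
        forall x, principal_ideal 2 x <-> ideal_prod p x].
End Ideals.

(* A number field is a K : fieldExtType rat (finite-dimensional over Q);    *)
(* following MathComp's algnum library we fix an embedding iota : K -> algC *)
(* and take R := { x in K | iota x is an algebraic integer }, which is the  *)
(* ring of integers of K (independently of the chosen embedding).            *)
Section RingOfIntegers.
Variables (K : fieldExtType rat) (iota : {rmorphism K -> algC}).

Definition int_pred : {pred K} := fun x => iota x \in Aint.

Lemma int_predE x : (x \in int_pred) = (iota x \in Aint).
Proof. by []. Qed.

Fact int_pred_subring : subring_closed int_pred.
Proof.
split; first by rewrite int_predE rmorph1 Aint1.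
  by move=> x y; rewrite !int_predE rmorphB; apply: rpredB.
by move=> x y; rewrite !int_predE rmorphM; apply: rpredM.
Qed.

HB.instance Definition _ := GRing.isSubringClosed.Build K int_pred int_pred_subring.

Record ringOfIntegers := RingOfIntegers {
  oint_val :> K;
  _ : oint_val \in int_pred }.

HB.instance Definition _ := [isSub for oint_val].
HB.instance Definition _ := [Choice of ringOfIntegers by <:].
HB.instance Definition _ := [SubChoice_isSubComNzRing of ringOfIntegers by <:].
End RingOfIntegers.

Section GaloisAction.
Variables (K : splittingFieldType rat) (iota : {rmorphism K -> algC}).
Local Notation OK := (ringOfIntegers iota).

Fact gal_int (g : gal_of (fullv : {vspace K})) (x : OK) : g (val x) \in int_pred iota.
Proof.
have [nu Hnu] := extend_algC_subfield_aut iota (gal_repr g).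
rewrite int_predE Hnu Aint_aut -int_predE.
by case: x.
Qed.

Definition gal_OK (g : gal_of (fullv : {vspace K})) (x : OK) : OK :=
  RingOfIntegers (gal_int g x).

Fact gal_OK_zmod g : zmod_morphism (gal_OK g).
Proof. by move=> x y; apply: val_inj; rewrite /= rmorphB. Qed.
Fact gal_OK_monoid g : monoid_morphism (gal_OK g).
Proof.
split; first by apply: val_inj; rewrite /= rmorph1.
by move=> x y; apply: val_inj; rewrite /= rmorphM.
Qed.
HB.instance Definition _ g := GRing.isZmodMorphism.Build _ _ (gal_OK g) (gal_OK_zmod g).
HB.instance Definition _ g := GRing.isMonoidMorphism.Build _ _ (gal_OK g) (gal_OK_monoid g).

Definition galOK (g : gal_of (fullv : {vspace K})) : {rmorphism OK -> OK} := gal_OK g.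
End GaloisAction.

(* Main.v *)
Require Import Defs.
From HB Require Import structures.
From mathcomp Require Import all_boot all_order all_algebra all_fingroup all_field.
From mathcomp Require Import boolp ring zify.
From Stdlib Require Cantor.

(* Write A = R[Z/2Z] and L for the free A-module of countable rank. A map     *)
(* between R-projective A-modules that is an isomorphism on the Tate          *)
(* cohomology of Z/2Z becomes an isomorphism after adding free modules: the   *)
(* kernel Q of a surjective version of it has trivial Tate cohomology, hence  *)
(* is A-projective, and Eilenberg's swindle gives Q + L = L. It is therefore  *)
(* enough to map sums of copies of R, with Y acting by 1 and by -1, to M[G]   *)
(* so that the Tate groups of M[G] are hit isomorphically. These groups are   *)
(* V[G] for the Tate groups V of M, which are modules over R/2R. As 2 is      *)
(* unramified, R/2R is a Galois extension of F_2 with group G, i.e. there are *)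
(* x_i, y_i with sum_i x_i g(y_i) = [g = 1] modulo 2. By Galois descent the   *)
(* constant families of an F_2-basis of V form an R/2R-basis of V[G].         *)
(* Projectivity of Q follows from Higman's criterion: an R-linear th with     *)
(* th + Y th Y = 1 exists modulo 2, as Q/2Q is free over F_2[Z/2Z] and the    *)
(* x_i, y_i average F_2-linear maps into R/2R-linear ones; it lifts since Q   *)
(* is R-projective, and the error 2 psi = psi + Y psi Y is then subtracted.   *)

(** The argument rests on these lemmas. [trivial_inertia] shows that no nontrivial element of G acts
    trivially on R/p for a prime p over 2: R/p is perfect ([prime_sqrt]) and 2 generates p locally,
    so triviality modulo p would propagate to all powers of p. The elements of R thus found are
    combined by the Chinese-remainder argument of [unramified_galois_coordinates]. [sgn_basis_map]
    is the descent step: for each sign it maps a free R-module on which Y acts by that sign to M[G],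
    inducing a bijection from its reduction modulo 2 to the corresponding Tate group. Adding a free
    module makes the sum of these two maps surjective without changing Tate groups. [tate_kernel]
    and [higman] show that the kernel is relatively projective, and [stable_equivalence] together
    with [swindle] then gives the isomorphism. *)

Set Implicit Arguments.
Unset Strict Implicit.
Unset Printing Implicit Defensive.

Import GRing.Theory Num.Theory.
Local Open Scope ring_scope.

(** * Normalization in abelian groups *)

Inductive zexp := ZVar of nat | Zero | ZAdd of zexp & zexp | ZOpp of zexp | ZMuln of zexp & nat.

Section Zexp.
Variable V : zmodType.

Fixpoint zeval (env : seq V) e := match e with
  | ZVar i => env`_i
  | Zero => 0
  | ZAdd a b => zeval env a + zeval env b
  | ZOpp a => - zeval env a
  | ZMuln a n => zeval env a *+ n
  end.

Fixpoint zcoef e i : int := match e with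
  | ZVar j => (i == j)%:Z
  | Zero => 0
  | ZAdd a b => zcoef a i + zcoef b i
  | ZOpp a => - zcoef a i
  | ZMuln a n => zcoef a i *+ n
  end.

Lemma zevalE env e : zeval env e = \sum_(i < size env) env`_i *~ zcoef e i.
Proof.
elim: e => [j||a IHa b IHb|a IHa|a IHa n] /=.
- have [ji|ji] := ltnP j (size env).
    rewrite (bigD1 (Ordinal ji)) //= eqxx mulr1z big1 ?addr0 // => i.
    by rewrite -val_eqE /= => /negbTE ->; rewrite mulr0z.
  rewrite nth_default // big1 // => i _.
  by rewrite ltn_eqF ?mulr0z // (leq_trans (ltn_ord i)).
- by rewrite big1 // => i _; rewrite mulr0z.
- by rewrite IHa IHb -big_split; apply: eq_bigr => i _; rewrite mulrzDr.
- by rewrite IHa -sumrN; apply: eq_bigr => i _; rewrite mulrNz.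
- by rewrite IHa -sumrMnl; apply: eq_bigr => i _; rewrite -mulr_natr mulrzA natz.
Qed.

(** This is the soundness of [abel]: both sides are determined by the integer coefficients of the
    atoms, and these are compared by computation. *)
Lemma zeval_eq env e1 e2 :
  all (fun i => zcoef e1 i == zcoef e2 i) (iota 0 (size env)) ->
  zeval env e1 = zeval env e2.
Proof.
move=> /allP h; rewrite !zevalE; apply: eq_bigr => i _.
by rewrite (eqP (h i _)) // mem_iota /=.
Qed.
End Zexp.

(* Atoms are compared up to conversion: the same operation may be reached     *)
(* through different paths in the hierarchy of structures.                    *)
Ltac zsame x y := match x with
  | y => constr:(true)
  | _ => let _ := constr:(erefl x : x = y) in constr:(true)
  | _ => constr:(false)
  end.

Ltac zindex x l := lazymatch l with
  | ?y :: ?t => lazymatch zsame x y with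
    | true => constr:(0%N)
    | false => let n := zindex x t in constr:(S n)
    end
  end.

Ltac zmem x l := lazymatch l with
  | nil => constr:(false)
  | ?y :: ?t => lazymatch zsame x y with true => constr:(true) | false => zmem x t end
  end.

Ltac zatoms t l := lazymatch t with
  | (?a + ?b)%R => let l1 := zatoms a l in zatoms b l1
  | (- ?a)%R => zatoms a l
  | (?a *+ _)%R => zatoms a l
  | 0%R => l
  | _ => lazymatch zmem t l with true => l | false => constr:(t :: l) end
  end.

Ltac zreify t l := lazymatch t with
  | (?a + ?b)%R => let x := zreify a l in let y := zreify b l in constr:(ZAdd x y)
  | (- ?a)%R => let x := zreify a l in constr:(ZOpp x)
  | (?a *+ ?n)%R => let x := zreify a l in constr:(ZMuln x n)
  | 0%R => constr:(Zero)
  | _ => let i := zindex t l in constr:(ZVar i)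
  end.

Ltac abel := match goal with |- @eq ?T ?a ?b =>
  let l0 := constr:(@nil T) in
  let l1 := zatoms a l0 in let l := zatoms b l1 in
  let x := zreify a l in let y := zreify b l in
  exact: (@zeval_eq _ l x y isT)
  end.

(** * Rings of integers *)

Section RingOfIntegersTheory.
Variables (K : splittingFieldType rat) (iota : {rmorphism K -> algC}).
Local Notation OK := (ringOfIntegers iota).
Local Notation G := (gal_of (fullv : {vspace K})).
Implicit Types (g h : G) (x : OK).

Lemma oint_natr_inj n x : n.+1%:R * x = 0 -> x = 0.
Proof.
move=> /(congr1 val); rewrite rmorphM rmorph_nat raddf0 => /eqP.
rewrite mulf_eq0 -(rmorph_nat (in_alg K)) fmorph_eq0 pnatr_eq0 /= => /eqP e.
exact: val_inj.
Qed.

Lemma oint_intr_eq0 (c : int) : (c%:~R : OK) = 0 -> c = 0.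
Proof.
move=> /(congr1 val); rewrite rmorph_int raddf0 => /eqP.
by rewrite -(rmorph_int (in_alg K)) fmorph_eq0 intr_eq0 => /eqP.
Qed.

(** Membership in [Aint] means that the minimal polynomial over Q has integer coefficients; its
    relation is pulled back along the injective [iota]. *)
Lemma oint_integral x :
  exists2 q : {poly int}, q \is monic & (map_poly intr q).[x] = 0.
Proof.
have : iota (val x) \in Aint by case: x.
rewrite unfold_in => /floorpP [q Dq].
have rq : (map_poly intr q).[iota (val x)] = 0.
  by rewrite -Dq; apply/rootP; exact: root_minCpoly.
have mq : q \is monic.
  have := minCpoly_monic (iota (val x)); rewrite Dq !monicE.
  rewrite lead_coef_map_inj //; last exact: intr_inj.
  by rewrite -[1 in X in X -> _]/(1%:~R) eqr_int.
exists q => //; apply: val_inj; apply: (fmorph_inj iota).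
rewrite [RHS]raddf0 -rq -(horner_map val) -(horner_map iota) -!map_poly_comp.
congr (_.[_]); apply: eq_map_poly => c.
by rewrite -[RHS](rmorph_int iota) -(rmorph_int (val : OK -> K)).
Qed.

Lemma galOK_M g h x : galOK iota (g * h)%g x = galOK iota h (galOK iota g x).
Proof. by apply: val_inj; rewrite /= galM ?memvf. Qed.

Lemma galOK_1 x : galOK iota 1%g x = x.
Proof. by apply: val_inj; rewrite /= gal_id. Qed.

Lemma galois_fullv : galois 1 (fullv : {vspace K}).
Proof.
apply/and3P; split; first exact: sub1v.
  by apply/separableP => y _; apply: pcharf0_separable => p; rewrite (pchar_lalg K) pchar_num.
exact: normalFieldf.
Qed.

(** The fixed field of the Galois group is Q, and a rational algebraic integer is an integer. *)
Lemma galOK_fixed x : (forall g, galOK iota g x = x) -> exists c : int, x = c%:~R.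
Proof.
move=> fx; have : val x \in fixedField ('Gal({:K} / 1))%g.
  apply/fixedFieldP; first exact: memvf.
  by move=> g _; rewrite -[in RHS](fx g).
rewrite (galois_fixedField galois_fullv) => /vlineP [r Dr].
have : iota (val x) \in Num.int.
  apply: Cint_rat_Aint; last by case: x {fx Dr}.
  by rewrite Dr alg_num_field fmorph_rat; apply/CratP; exists r.
move=> /intrP [c Dc]; exists c; apply: val_inj; apply: (fmorph_inj iota).
by rewrite Dc !rmorph_int.
Qed.

(** Every element of K has a nonzero integer multiple in R, and such a multiple of an element moved
    by [g] is again moved. *)
Lemma galOK_faithful g : g != 1%g -> exists x, galOK iota g x <> x.
Proof.
move=> ng; have [y gy] : exists y : K, g y != y.
  apply: contrapT => gid; move/negP: ng; apply; apply/gal_eqP => y _.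
  by rewrite gal_id; apply: contrapT => /eqP gy; apply: gid; exists y.
have [n n0 Dn] : exists2 n : int, n != 0 & (n%:~R * y : K) \in int_pred iota.
  have [p [Dp mp] _] := minCpolyP (iota y).
  have [q [a nz_a Dq]] := rat_poly_scale p.
  exists a => //; set P := minCpoly (iota y) in Dp.
  have mP : P \is monic by exact: minCpoly_monic.
  have sP : size P = (size P).-1.+1.
    by rewrite prednK // size_poly_gt0 monic_neq0.
  (* Here [a] clears the denominators of [P]. With n the degree of [P], the polynomial with
     coefficients P_i a^(n-i) is monic and integral, and it vanishes at a y. *)
  pose r := \poly_(i < (size P).-1.+1) (P`_i * a%:~R ^+ ((size P).-1 - i)).
  have PZ i : a%:~R * P`_i \in Num.int.
    rewrite Dp coef_map Dq coefZ coef_map /= rmorphM fmorphV !rmorph_int mulVKf.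
      exact: intr_int.
    by rewrite intr_eq0.
  apply: (@root_monic_Aint r).
  - apply/rootP; rewrite /r horner_poly.
    rewrite (eq_bigr (fun i : 'I__ => a%:~R ^+ (size P).-1 * (P`_i * iota y ^+ i))).
      rewrite -big_distrr /= -sP -horner_coef.
      by rewrite (rootP (root_minCpoly (iota y))) mulr0.
    move=> i _; rewrite rmorphM rmorph_int exprMn.
    have -> : (a%:~R : algC) ^+ (size P).-1 = a%:~R ^+ ((size P).-1 - i) * a%:~R ^+ i.
      by rewrite -exprD subnK // -ltnS.
    by rewrite !mulrA; congr (_ * _); rewrite -mulrA mulrC.
  - rewrite monicE lead_coef_poly // subnn expr0 mulr1.
      by rewrite -lead_coefE (monicP mP).
    by rewrite -lead_coefE (monicP mP) oner_eq0.
  apply/polyOverP => i; rewrite coef_poly; case: ifP => // ilt; last exact: rpred0.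
  rewrite ltnS leq_eqVlt in ilt; case/orP: ilt => [/eqP ->|ilt].
    by rewrite subnn expr0 mulr1 -lead_coefE (monicP mP) rpred1.
  have /prednK <- : (0 < (size P).-1 - i)%N by rewrite subn_gt0.
  rewrite exprS mulrA [P`_i * _]mulrC.
  by rewrite rpredM // rpredX // intr_int.
exists (RingOfIntegers Dn) => /(congr1 val) /= /eqP.
rewrite rmorphM rmorph_int; rewrite -subr_eq0 -mulrBr mulf_eq0 subr_eq0.
rewrite (negbTE gy) orbF -(rmorph_int (in_alg K)) fmorph_eq0 intr_eq0.
by rewrite (negbTE n0).
Qed.

Lemma oint_integral_domain x (y : OK) : x * y = 0 -> x = 0 \/ y = 0.
Proof.
move=> /(congr1 val); rewrite rmorphM raddf0 => /eqP.
by rewrite mulf_eq0 => /orP [] /eqP e; [left|right]; apply: val_inj.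
Qed.

Lemma oint_countable : exists f : OK -> nat, injective f.
Proof.
exists (fun x => pickle (VectorInternalTheory.v2r (val x))) => x y.
by move/(pcan_inj pickleK)/VectorInternalTheory.v2r_inj/val_inj.
Qed.
End RingOfIntegersTheory.

(** * Prime ideals over 2 *)

Lemma int_parity (c : int) : exists d : int, c = d *+ 2 \/ c = d *+ 2 + 1.
Proof.
exists (c %/ 2)%Z; have := divz_eq c 2.
have : (0 <= (c %% 2)%Z < 2)%R by rewrite modz_ge0 // ltz_mod.
case: (c %% 2)%Z => [[|[|n]]|n] //= _ {1 3}->; [left|right].
  by rewrite addr0 mulr_natr.
by rewrite mulr_natr.
Qed.

(** This says that q vanishes in F_2[X]. Integer polynomials stand below for polynomials over F_2,
    and the negation replaces being nonzero there. *)
Definition even_coefs (q : {poly int}) := exists r, q = r *+ 2.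

Section PrimeIdealsOver2.
Variables (R : comNzRingType) (p : R -> Prop).
Hypotheses (pP : is_prime_ideal p) (p2 : p 2).
Implicit Types (x y z : R) (q : {poly int}).

Local Notation ev q x := (map_poly (intr : int -> R) q).[x].

Lemma prime0 : p 0. Proof. by case: pP => [[]]. Qed.

Lemma primeMl a x : p x -> p (a * x).
Proof. by case: pP => [[_ _ pM] _ _]; apply: pM. Qed.

Lemma primeMr a x : p x -> p (x * a).
Proof. by rewrite mulrC; exact: primeMl. Qed.

Lemma primeB x y : p x -> p y -> p (x - y).
Proof. by case: pP => [[_ pB _] _ _]; apply: pB. Qed.

Lemma primeN x : p x -> p (- x).
Proof. by rewrite -[- x]sub0r; apply: primeB; exact: prime0. Qed.

Lemma prime_proper : ~ p 1. Proof. by case: pP. Qed.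

Lemma primeM_inv x y : p (x * y) -> p x \/ p y.
Proof. by case: pP => _ _; apply. Qed.

Lemma prime_not_odd (d : int) : ~ p (d *+ 2 + 1)%:~R.
Proof.
rewrite intrD rmorphMn /= -mulr_natl => pd; apply: prime_proper.
have -> : 1 = (2 * d%:~R + 1) - 2 * (d%:~R : R) by ring.
by apply: primeB => //; exact: primeMr.
Qed.

Lemma horner_int_MXaddC q (c : int) x : ev (q * 'X + c%:P) x = ev q x * x + c%:~R.
Proof. by rewrite rmorphD rmorphM /= map_polyX map_polyC !hornerE. Qed.

(** R/p is a domain, so an element algebraic over F_2 and nonzero modulo p is invertible: factors X
    of q modulo 2 are cancelled until the constant term is odd, and q = q' X + 1 modulo 2 then
    exhibits -q'(x) as the inverse. *)
Lemma prime_inv_root q x : ~ even_coefs q -> p (ev q x) -> ~ p x ->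
  exists y, p (y * x - 1).
Proof.
move=> + + nx; elim/poly_ind: q => [|q c IH] qN.
  by case: qN; exists 0; rewrite mul0rn.
rewrite horner_int_MXaddC; have [d [Dc|Dc]] := int_parity c => pq.
  apply: IH.
    move=> [r Dr]; apply: qN; exists (r * 'X + d%:P).
    by rewrite Dc Dr mulrnDl mulrnAl polyCMn.
  have : p (ev q x * x).
    rewrite -[_ * x](addrK c%:~R); apply: primeB => //.
    by rewrite Dc rmorphMn /= -mulr_natl; apply: primeMr.
  by case/primeM_inv.
exists (- ev q x).
have -> : - ev q x * x - 1 = 2 * d%:~R - (ev q x * x + c%:~R).
  by rewrite Dc intrD rmorphMn /= -mulr_natl; ring.
by apply: primeB => //; exact: primeMr.
Qed.

Hypothesis integralR : forall x, exists2 q, q \is monic & ev q x = 0.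

Lemma monic_not_even q : q \is monic -> ~ even_coefs q.
Proof.
rewrite monicE => /eqP + [r Dr]; rewrite lead_coefE Dr coefMn => e.
by rewrite mulr2n in e; lia.
Qed.

Lemma prime_inv x : ~ p x -> exists y, p (y * x - 1).
Proof.
have [q /monic_not_even qN q0] := integralR x.
by apply: prime_inv_root qN _; rewrite q0; exact: prime0.
Qed.

Lemma horner_int_sqr q x : exists t, ev q (x ^+ 2) = ev q x ^+ 2 + 2 * t.
Proof.
elim/poly_ind: q => [|q c [t IH]].
  by exists 0; rewrite rmorph0 !horner0 expr0n mulr0 addr0.
have [k Dk] : exists k : int, c = c ^+ 2 + 2 * k.
  have [d [Dc|Dc]] := int_parity c.
    by exists (d - 2 * d ^+ 2); rewrite Dc; ring.
  by exists (- 2 * d ^+ 2 - d); rewrite Dc; ring.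
rewrite !horner_int_MXaddC IH; exists (t * x ^+ 2 + k%:~R - c%:~R * ev q x * x).
by rewrite {1}Dk intrD rmorphXn intrM; ring.
Qed.

(** The field R/p is perfect. Writing q = E(X^2) + O(X^2) X, the Frobenius turns q(x) = 0 into
    E(x)^2 + O(x)^2 x = 0 modulo p. If O(x) is invertible, then x is the square of E(x)/O(x).
    Otherwise E and O both vanish at x, and one of them is nonzero modulo 2 and shorter than q. *)
Lemma prime_sqrt q x : ~ even_coefs q -> p (ev q x) -> exists z, p (x - z ^+ 2).
Proof.
have [n] := ubnP (size q); elim: n q => // n IH q; rewrite ltnS => sq qN pq.
have [sq1|sq1] := leqP (size q) 1.
  have Dq := size1_polyC sq1; have [d [Dc|Dc]] := int_parity q`_0.
    by case: qN; exists d%:P; rewrite Dq Dc polyCMn.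
  by move: pq; rewrite Dq map_polyC hornerC Dc => /prime_not_odd.
set E := even_poly q; set O := odd_poly q.
have Dq : q = E \Po 'X^2 + (O \Po 'X^2) * 'X by rewrite poly_even_odd.
have evX2 r : ev (r \Po 'X^2) x = ev r (x ^+ 2).
  by rewrite map_comp_poly map_polyXn horner_comp hornerXn.
have EO : p (ev E x ^+ 2 + ev O x ^+ 2 * x).
  move: pq; rewrite Dq rmorphD rmorphM /= map_polyX hornerD hornerM hornerX !evX2.
  have [t ->] := horner_int_sqr E x; have [s ->] := horner_int_sqr O x => h.
  have -> : ev E x ^+ 2 + ev O x ^+ 2 * x =
    ev E x ^+ 2 + 2 * t + (ev O x ^+ 2 + 2 * s) * x - 2 * (t + s * x) by ring.
  by apply: primeB => //; exact: primeMr.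
have [pO|pO] := pselect (p (ev O x)); last first.
  have [y py] := prime_inv pO; exists (y * ev E x).
  have -> : x - (y * ev E x) ^+ 2 =
    y ^+ 2 * (ev E x ^+ 2 + ev O x ^+ 2 * x) - 2 * (y * ev E x) ^+ 2
    - (y * ev O x - 1) * (y * ev O x + 1) * x by ring.
  apply: primeB; last by apply: primeMr; exact: primeMr.
  by apply: primeB; [exact: primeMl|exact: primeMr].
have pE : p (ev E x).
  have : p (ev E x * ev E x).
    rewrite -expr2 -[_ ^+ 2](addrK (ev O x ^+ 2 * x)).
    by apply: primeB => //; apply: primeMr; rewrite expr2; exact: primeMl.
  by case/primeM_inv.
have size_half : (uphalf (size q) < n)%N.
  apply: leq_trans sq; rewrite uphalf_half; move: sq1.
  by have := odd_double_half (size q); case: (odd _) => /=; lia.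
have [evE|] := pselect (even_coefs E); last first.
  by move=> /IH; apply => //; apply: leq_ltn_trans (size_poly _ _) _.
apply: (IH O) => //.
  apply: leq_ltn_trans (size_poly _ _) _; apply: leq_ltn_trans size_half.
  by rewrite uphalf_half leq_addl.
move: evE => [r Er] [s Os]; apply: qN; exists ((r \Po 'X^2) + (s \Po 'X^2) * 'X).
by rewrite Dq Er Os mulrnDl -mulrnAl; rewrite !raddfMn.
Qed.
End PrimeIdealsOver2.

(** * Galois coordinates modulo 2 *)

Section UnramifiedGalois.
Variables (R : comNzRingType) (G : finGroupType) (act : G -> {rmorphism R -> R}).
Hypotheses
  (actM : forall g h x, act (g * h)%g x = act h (act g x))
  (act1 : forall x, act 1%g x = x)
  (torsion_free : forall n x, n.+1%:R * x = 0 :> R -> x = 0)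
  (domainR : forall x y : R, x * y = 0 -> x = 0 \/ y = 0)
  (integralR : forall x : R,
     exists2 q : {poly int}, q \is monic & (map_poly intr q).[x] = 0)
  (fixedR : forall x, (forall g, act g x = x) -> exists c : int, x = c%:~R)
  (faithfulR : forall g, g != 1%g -> exists x, act g x <> x).

Lemma act_inj g : injective (act g).
Proof. by apply: (can_inj (g := act g^-1%g)) => x; rewrite -actM mulgV act1. Qed.

Section TrivialInertia.
Variables (p : R -> Prop) (e : R).
Hypotheses (pP : is_prime_ideal p) (p2 : p 2).
Hypotheses (pNe : ~ p e) (pe : forall y, p y -> exists t, e * y = 2 * t).

(* The contraction to R of the m-th power of the maximal ideal of the         *)
(* localization at p, in which 2 is a uniformizer.                            *)
Definition loc_pow m z := exists u t, ~ p u /\ u * z = 2 ^+ m * t.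

Lemma loc_pow_p z : p z -> loc_pow 1 z.
Proof. by move=> /pe[t et]; exists e, t; rewrite expr1. Qed.

Lemma prime_notM u v : ~ p u -> ~ p v -> ~ p (u * v).
Proof. by move=> pu pv /(primeM_inv pP) []. Qed.

Lemma loc_powD m x y : loc_pow m x -> loc_pow m y -> loc_pow m (x + y).
Proof.
move=> [u [t [pu ut]]] [v [s [pv vs]]]; exists (u * v), (v * t + u * s).
split; first exact: prime_notM.
have -> : u * v * (x + y) = v * (u * x) + u * (v * y) by ring.
by rewrite ut vs; ring.
Qed.

Lemma loc_powM m n x y : loc_pow m x -> loc_pow n y -> loc_pow (m + n) (x * y).
Proof.
move=> [u [t [pu ut]]] [v [s [pv vs]]]; exists (u * v), (t * s).
by split; [exact: prime_notM|rewrite mulrACA ut vs exprD; ring].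
Qed.

Lemma loc_pow0 x : loc_pow 0 x.
Proof. by exists 1, x; split; [exact: prime_proper|rewrite expr0]. Qed.

Lemma loc_powMl m a x : loc_pow m x -> loc_pow m (a * x).
Proof. by move=> h; have := loc_powM (loc_pow0 a) h. Qed.

Lemma loc_pow_le m n x : (m <= n)%N -> loc_pow n x -> loc_pow m x.
Proof.
move=> mn [u [t [pu ut]]]; exists u, (2 ^+ (n - m) * t).
by rewrite mulrA -exprD subnKC.
Qed.

Lemma loc_pow_cancel m u x : ~ p u -> loc_pow m (u * x) -> loc_pow m x.
Proof.
by move=> pu [v [t [pv vt]]]; exists (v * u), t; rewrite -mulrA; split; [exact: prime_notM|].
Qed.

(** By descent on |c|: an odd integer lies outside p, and an even one can be halved since R has no
    2-torsion, which lowers each exponent by one. *)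
Lemma loc_pow_int (c : int) : (forall m, loc_pow m.+1 c%:~R) -> c = 0.
Proof.
have [n] := ubnP `|c|%N; elim: n c => // n IH c.
have [d [Dc|Dc]] := int_parity c => cn cI.
  suff d0 : d = 0 by rewrite Dc d0 mul0rn.
  have [->//|nd] := eqVneq d 0.
  apply: IH => [|m]; first by rewrite mulr2n in Dc; lia.
  have [u [t [pu ut]]] := cI m.+1; exists u, t; split => //.
  have /(@torsion_free 1) : 2 * (u * d%:~R - 2 ^+ m.+1 * t) = 0.
    have -> : 2 * (u * d%:~R - 2 ^+ m.+1 * t) = u * (2 * d%:~R) - 2 ^+ m.+2 * t.
      by rewrite [2 ^+ m.+2]exprS; ring.
    by rewrite -ut Dc rmorphMn /= mulr_natl subrr.
  by move=> /eqP; rewrite subr_eq0 => /eqP.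
have [u [t [pu]]] := cI 0; rewrite expr1 => ut.
have : p (u * c%:~R) by rewrite ut; apply: primeMr.
by case/(primeM_inv pP) => //; rewrite Dc => /(prime_not_odd pP p2).
Qed.

(** If [g] is the identity modulo p, then it is so modulo every power of p. Indeed x = z^2 + y with
    y in p. The difference (g z)^2 - z^2 gains one power of p from the factor 2 and from squaring; g
    y - y gains one because e y = 2 t, where e is invertible at p. *)
Lemma trivial_inertia g : g != 1%g -> exists x, ~ p (act g x - x).
Proof.
move=> /faithfulR [x0 gx0]; apply: contrapT => gN.
have gp x : p (act g x - x) by apply: contrapT => gx; apply: gN; exists x.
have gI m x : loc_pow m.+1 (act g x - x).
  elim: m x => [|m IH] x; first exact: loc_pow_p.
  have [z pz] : exists z, p (x - z ^+ 2).
    have [q mq qx] := integralR x.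
    apply: (prime_sqrt pP p2 integralR (monic_not_even mq)).
    by rewrite qx; exact: prime0.
  set y := x - z ^+ 2 in pz.
  have -> : act g x - x = (2 * z * (act g z - z) + (act g z - z) * (act g z - z))
                          + (act g y - y).
    by rewrite /y rmorphB rmorphXn /=; ring.
  apply: loc_powD.
    apply: loc_powD.
      rewrite mulrAC mulrC; apply: loc_powMl; apply: (@loc_powM 1 m.+1) => //.
      exact: loc_pow_p.
    by apply: (@loc_pow_le _ (m.+1 + m.+1)); [lia|exact: loc_powM].
  have [t et] := pe pz.
  apply: (@loc_pow_cancel _ (act g e)).
    by move=> pge; apply: pNe; rewrite -[e](subKr (act g e)); apply: primeB.
  have -> : act g e * (act g y - y) = 2 * (act g t - t) + - 1 * (y * (act g e - e)).
    have /(congr1 (act g)) := et; rewrite !rmorphM rmorph_nat mulrBr => ->.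
    have -> : 2 * (act g t - t) = 2 * act g t - e * y by rewrite et; ring.
    by ring.
  by apply: loc_powD; [|apply: loc_powMl]; apply: (@loc_powM 1 m.+1) => //; exact: loc_pow_p.
set d := act g x0 - x0.
have nz h : act h d <> 0.
  rewrite -(rmorph0 (act h)) => /act_inj /eqP; rewrite subr_eq0 => /eqP; exact: gx0.
(* The norm of [d] is a nonzero integer that lies in every power of p, which [loc_pow_int]
   excludes. *)
have [c Dc] : exists c : int, \prod_h act h d = c%:~R.
  apply: fixedR => k; rewrite rmorph_prod [RHS](reindex_inj (mulIg k)) /=.
  by apply: eq_bigr => h _; rewrite actM.
have : c = 0.
  apply: loc_pow_int => m; rewrite -Dc (bigD1 1%g) //= mulrC act1.
  by apply: loc_powMl; exact: gI.
move=> c0; have : \prod_h act h d <> 0; last by rewrite Dc c0.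
apply: (big_ind (fun x => x <> 0)) => // [|x y nx ny /domainR []//].
by apply/eqP; rewrite oner_eq0.
Qed.
End TrivialInertia.

Lemma foldr_ideal_mul (I : eqType) (p : I -> R -> Prop) (s : seq I) :
  (forall i, is_ideal (p i)) ->
  let J := foldr (fun i J => ideal_mul (p i) J) (fun _ => True) s in
  (forall z : I -> R, (forall i, i \in s -> p i (z i)) -> J (\prod_(i <- s) z i)) /\
  (forall x i, i \in s -> J x -> p i x).
Proof.
move=> pI; elim: s => [|j s [IH1 IH2]] /=; first by split.
split=> [z pz|x i].
  rewrite big_cons; exists 1%N, (fun=> z j), (fun=> \prod_(i <- s) z i).
  split=> [_|_|]; last by rewrite big_ord1.
    by apply: pz; rewrite mem_head.
  by apply: IH1 => i si; apply: pz; rewrite inE si orbT.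
move=> si [n [a [b [pa Jb ->]]]]; have [p0 pB pM] := pI i.
have pD u v : p i u -> p i v -> p i (u + v).
  by move=> pu pv; rewrite -[v]opprK -[- v]sub0r; apply: (pB) => //; apply: (pB).
apply: (big_ind (p i)) => // k _; move: si; rewrite inE => /orP [/eqP ij|si].
  by rewrite mulrC; apply: (pM); rewrite ij.
by apply: (pM); apply: IH2.
Qed.

(** These functions are the image of the tensor product of R with itself over Z, where a tensor b
    goes to g |-> a g(b). They form a ring, so the required tensor can be built by sums and products
    of functions. *)
Definition is_tensor (f : G -> R) :=
  exists s : seq (R * R), forall g, f g = \sum_(t <- s) t.1 * act g t.2.

Lemma tensor_const a : is_tensor (fun=> a).
Proof. by exists [:: (a, 1)] => g; rewrite big_seq1 rmorph1 mulr1. Qed.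

Lemma tensor_act x : is_tensor (fun g => act g x).
Proof. by exists [:: (1, x)] => g; rewrite big_seq1 mul1r. Qed.

Lemma tensorD f1 f2 : is_tensor f1 -> is_tensor f2 -> is_tensor (fun g => f1 g + f2 g).
Proof. by move=> [s1 D1] [s2 D2]; exists (s1 ++ s2) => g; rewrite big_cat D1 D2. Qed.

Lemma tensorM f1 f2 : is_tensor f1 -> is_tensor f2 -> is_tensor (fun g => f1 g * f2 g).
Proof.
move=> [s1 D1] [s2 D2]; exists [seq (t1.1 * t2.1, t1.2 * t2.2) | t1 <- s1, t2 <- s2] => g.
rewrite D1 D2 big_allpairs_dep big_distrl /=; apply: eq_bigr => t1 _.
by rewrite big_distrr; apply: eq_bigr => t2 _ /=; rewrite rmorphM; ring.
Qed.

Lemma tensor_prod (I : Type) (s : seq I) (P : pred I) (f : I -> G -> R) :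
  (forall i, P i -> is_tensor (f i)) -> is_tensor (fun g => \prod_(i <- s | P i) f i g).
Proof.
move=> fT; elim: s => [|i s [t IH]].
  by have [t Dt] := tensor_const 1; exists t => g; rewrite big_nil (Dt g).
have [Pi|nPi] := boolP (P i); last first.
  by exists t => g; rewrite big_cons (negbTE nPi).
have [|u Du] := tensorM (fT i Pi) (f2 := fun g => \prod_(i <- s | P i) f i g).
  by exists t.
by exists u => g; rewrite big_cons Pi (Du g).
Qed.

(* The ring R is a Galois extension of its G-invariants modulo 2, in the      *)
(* sense of Chase, Harrison and Rosenberg.                                    *)
Lemma unramified_galois_coordinates : unramified_at_2 R ->
  exists s : seq (R * R), forall g,
    exists r, \sum_(t <- s) t.1 * act g t.2 = (g == 1%g)%:R + 2 * r.
Proof.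
move=> [n [p [pP pneq pprod]]].
have pI i : is_ideal (p i) by case: (pP i).
have [Jprod Jsub] := foldr_ideal_mul (enum 'I_n) pI.
have p2 i : p i 2.
  apply: Jsub; first by rewrite mem_enum.
  by apply/pprod; exists 1; rewrite mul1r.
have prod2 (z : 'I_n -> R) : (forall i, p i (z i)) -> exists t, \prod_i z i = 2 * t.
  move=> pz; have /pprod [t Dt] : ideal_prod p (\prod_(i <- enum 'I_n) z i).
    by apply: Jprod.
  by exists t; rewrite -big_enum /= Dt mulrC.
(* Each p_j is maximal, as R/p_j is a field; being different from p_i, it is not contained in it. A
   product of elements of the other p_j outside p_i is the desired [e]. *)
have sep i : exists e, ~ p i e /\ forall y, p i y -> exists t, e * y = 2 * t.
  have /choice [f fP] : forall j, exists e, j != i -> p j e /\ ~ p i e.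
    move=> j; have [->|ji] := eqVneq j i; first by exists 0.
    apply: contrapT => H; apply: (pneq _ _ ji) => x.
    have sub y : p j y -> p i y.
      by move=> pjy; apply: contrapT => piy; apply: H; exists y.
    split=> [|pix]; first exact: sub.
    apply: contrapT => /(prime_inv (pP j) (p2 j) integralR) [w /sub].
    move=> pw; apply: (prime_proper (pP i)).
    by rewrite -[1](subKr (w * x)); apply: primeB => //; apply: primeMl.
  exists (\prod_(j | j != i) f j); split.
    apply: (big_ind (fun x => ~ p i x)) => [|x y nx ny|j ji]; first exact: prime_proper.
      by move=> /(primeM_inv (pP i)) [].
    by case: (fP j ji).
  move=> y py; have [|t Dt] := prod2 (fun j => if j == i then y else f j).
    by move=> j; case: eqVneq => [->//|/fP []].
  exists t; rewrite -Dt [RHS](bigD1 i) //= eqxx mulrC; congr (_ * _).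
  by apply: eq_bigr => j /negbTE ->.
have psi h i : h != 1%g -> exists f, [/\ is_tensor f, p i (f 1%g) & f h = 1].
  move=> nh; have [e [pe eP]] := sep i.
  have [x xh] := trivial_inertia (pP i) (p2 i) pe eP nh.
  have [y Dy] := prime_inv (pP i) (p2 i) integralR xh.
  (* As y inverts h(x) - x modulo p_i, this function is 1 at g = h and lies in p_i at the
     identity. *)
  exists (fun g => 1 + - y * (act h x + -1 * act g x)); split.
  - apply: tensorD; first exact: tensor_const.
    apply: tensorM; first exact: tensor_const.
    apply: tensorD; first exact: tensor_const.
    by apply: tensorM; [exact: tensor_const|exact: tensor_act].
  - rewrite act1.
    have -> : 1 + - y * (act h x + -1 * x) = - (y * (act h x - x) - 1) by ring.
    exact: primeN.
  by ring.
have Phi h : exists f, h != 1%g -> [/\ is_tensor f, exists t, f 1%g = 1 + 2 * t & f h = 0].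
  have [->|nh] := eqVneq h 1%g; first by exists (fun=> 0).
  have /choice [f fP] := fun i => psi h i nh.
  (* At h all factors are 1; at the identity the product lies in the product of the p_i, that is, in
     2R. *)
  exists (fun g => 1 + -1 * \prod_i f i g) => _; split.
  - apply: tensorD; first exact: tensor_const.
    apply: tensorM; first exact: tensor_const.
    by apply: tensor_prod => i _; case: (fP i).
  - have [|t ->] := prod2 (fun i => f i 1%g); first by move=> i; case: (fP i).
    by exists (- t); ring.
  by rewrite big1 => [|i _]; [ring|case: (fP i)].
have /choice [F FP] := Phi.
(* The product over all h <> 1 vanishes at each such h and is 1 modulo 2 at the identity. *)
have [|s Ds] := @tensor_prod _ (index_enum G) (fun h => h != 1%g) F.
  by move=> h /FP [].
exists s => g; rewrite -Ds; have [->|ng] := eqVneq g 1%g.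
  apply: (big_ind (fun x => exists r, x = 1 + 2 * r)) => [|_ _ [a ->] [b ->]|h /FP []//].
    by exists 0; ring.
  by exists (a + b + 2 * a * b); ring.
exists 0; rewrite (bigD1 g) //=; have [_ _ ->] := FP g ng; by rewrite mul0r mulr0 addr0.
Qed.
End UnramifiedGalois.

(** * Modules over the group ring of Z/2Z *)

Section LinearCombination.
Variables (A : comNzRingType) (X : lmodType A) (m : nat -> X).

Definition lincomb (p : {poly A}) : X := \sum_(n < size p) p`_n *: m n.

Lemma lincombE N (p : {poly A}) : (size p <= N)%N -> lincomb p = \sum_(n < N) p`_n *: m n.
Proof.
move=> pN; rewrite /lincomb (big_ord_widen N (fun n => p`_n *: m n) pN).
rewrite big_mkcond; apply: eq_bigr => i _; case: ltnP => // /(nth_default 0) ->.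
by rewrite scale0r.
Qed.

Lemma lincomb_linear : linear lincomb.
Proof.
move=> a p q; set N := maxn (size p) (size q).
have pN : (size p <= N)%N by rewrite leq_maxl.
have qN : (size q <= N)%N by rewrite leq_maxr.
have rN : (size (a *: p + q)%R <= N)%N.
  by rewrite (leq_trans (size_polyD _ _)) // geq_max qN (leq_trans (size_scale_leq _ _)).
rewrite !(lincombE (N := N)) // scaler_sumr -big_split; apply: eq_bigr => i _.
by rewrite coefD coefZ scalerDl scalerA.
Qed.

HB.instance Definition _ := GRing.isLinear.Build A {poly A} X *:%R lincomb lincomb_linear.

Lemma lincombXn n : lincomb 'X^n = m n.
Proof.
rewrite (lincombE (N := n.+1)) ?size_polyXn // big_ord_recr /= coefXn eqxx.
rewrite scale1r big1 ?add0r // => i _.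
by rewrite coefXn ltn_eqF ?scale0r.
Qed.
End LinearCombination.

Section GroupRingZ2.
Variable R : comNzRingType.
Local Notation A := (RZ2 R).
Local Notation Y := (YZ2 R).

Lemma XX1_monic : ('X^2 - 1 : {poly R}) \is monic.
Proof. by rewrite -[1]/(1%:P) monicXnsubC. Qed.

Lemma size_XX1 : size ('X^2 - 1 : {poly R}) = 3.
Proof. by rewrite -[1]/(1%:P) size_XnsubC. Qed.

Lemma mk_monic_XX1 : mk_monic ('X^2 - 1 : {poly R}) = 'X^2 - 1.
Proof. by rewrite /mk_monic size_XX1 XX1_monic. Qed.

Lemma YZ2E : Y = 'X :> {poly R}.
Proof. by apply: qpolyXE; rewrite ?size_XX1 ?XX1_monic. Qed.

Lemma YZ2_sqr : Y * Y = 1.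
Proof.
rewrite /YZ2 /qpolyX -in_qpolyM -in_qpoly1 -expr2; apply/eqP; rewrite -subr_eq0 -rmorphB /=.
apply/eqP; apply: val_inj; rewrite /= mk_monic_XX1.
by rewrite Pdiv.RingMonic.rmodpp // XX1_monic.
Qed.

Lemma RZ2_size (z : A) : (size (z : {poly R}) <= 2)%N.
Proof.
rewrite -ltnS (leq_trans (size_mk_monic z)) //.
by rewrite mk_monic_XX1 size_XX1.
Qed.

Lemma RZ2_algE (a : R) : (a%:A : A) = a%:P :> {poly R}.
Proof. by rewrite -[LHS]/(a *: (1 : {poly R})) alg_polyC. Qed.

Lemma RZ2_XE (z : A) : z = (z`_0)%:A + (z`_1)%:A * Y.
Proof.
have -> : (z`_1)%:A * Y = z`_1 *: Y by rewrite -scalerAl mul1r.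
apply: val_inj; apply/polyP => i.
rewrite -[RHS]/((z`_0 *: (1 : {poly R}) + z`_1 *: (Y : {poly R}))`_i) YZ2E.
rewrite coefD !coefZ coef1 coefX.
case: i => [|[|i]] /=; rewrite ?mulr1 ?mulr0 ?addr0 ?add0r //.
by rewrite nth_default // (leq_trans (RZ2_size z)).
Qed.

Section TwistRules.
Variable s : {rmorphism R -> R}.

Lemma twistZ2_alg a : twistZ2 s (a%:A : A) = (s a)%:A.
Proof.
rewrite /twistZ2 RZ2_algE map_polyC; apply: val_inj.
rewrite [LHS]in_qpoly_small; first by rewrite -RZ2_algE.
by rewrite mk_monic_XX1 size_XX1 size_polyC; case: eqP.
Qed.

Lemma twistZ2_Y : twistZ2 s Y = Y.
Proof. by rewrite /twistZ2 YZ2E map_polyX. Qed.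
End TwistRules.

(** Scalars of R act through [a%:A], so that R-linear maps can be mixed with the action of Y without
    passing to [resR]. *)
Definition R_linear (U V : lmodType A) (f : U -> V) :=
  forall (a : R) x y, f (a%:A *: x + y) = a%:A *: f x + f y.

Section RLinear.
Variables (U V : lmodType A) (f : U -> V).
Hypothesis fR : R_linear f.

Lemma R_linearD : {morph f : x y / x + y}.
Proof. by move=> x y; have := fR 1 x y; rewrite !scale1r. Qed.

Lemma R_linear0 : f 0 = 0.
Proof. by apply: (addrI (f 0)); rewrite -R_linearD !addr0. Qed.

Lemma R_linearZ a : {morph f : x / a%:A *: x}.
Proof. by move=> x; have := fR a x 0; rewrite R_linear0 !addr0. Qed.

Lemma R_linear_sum (I : Type) (r : seq I) (P : pred I) (F : I -> U) :
  f (\sum_(i <- r | P i) F i) = \sum_(i <- r | P i) f (F i).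
Proof. exact: (big_morph f R_linearD R_linear0). Qed.

Lemma R_linear_A : (forall x, f (Y *: x) = Y *: f x) -> linear f.
Proof.
move=> fY z x y; rewrite R_linearD; congr (_ + _).
rewrite [in RHS](RZ2_XE z) [in LHS](RZ2_XE z).
move: (z`_0) (z`_1) => a b.
by rewrite !scalerDl R_linearD R_linearZ -!scalerA R_linearZ fY.
Qed.
End RLinear.

Lemma YZ2K (V : lmodType A) : involutive (fun x : V => Y *: x).
Proof. by move=> x; rewrite scalerA YZ2_sqr scale1r. Qed.

Lemma YZ2_algC (V : lmodType A) (a : A) (x : V) : Y *: (a *: x) = a *: (Y *: x).
Proof. by rewrite !scalerA mulrC. Qed.

Definition R_lincomb (X : lmodType A) (m : nat -> X) (p : {poly R}) : X :=
  lincomb (m : nat -> resR X) p.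

Lemma R_lincombP (X : lmodType A) (m : nat -> X) a p q :
  R_lincomb m (a *: p + q) = a%:A *: R_lincomb m p + R_lincomb m q.
Proof. exact: (@lincomb_linear R (resR X)). Qed.

Lemma R_lincombE (X : lmodType A) (m : nat -> X) N (p : {poly R}) :
  (size p <= N)%N -> R_lincomb m p = \sum_(n < N) (p`_n)%:A *: m n.
Proof. exact: (@lincombE R (resR X)). Qed.

Lemma R_lincombZ (X : lmodType A) (m : nat -> X) a p :
  R_lincomb m (a *: p) = a%:A *: R_lincomb m p.
Proof.
rewrite -[a *: p]addr0 R_lincombP (@R_lincombE X m 0 0) ?size_poly0 //.
by rewrite big_ord0 addr0.
Qed.

(** This is a dual basis over R: P is a retract of a finite sum of copies of the free R-module of
    countable rank. In this form R-projectivity passes easily to sums, retracts and twists. *)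
Definition coordinatized (P : lmodType A) :=
  exists (I : finType) (c : I -> P -> {poly R}) (m : I -> nat -> P),
    (forall i a x y, c i (a%:A *: x + y) = a *: c i x + c i y) /\
    (forall x, x = \sum_i R_lincomb (m i) (c i x)).

Section Lifting.
Variables (P X : lmodType A) (W : X -> Prop).
Hypotheses (W0 : W 0) (WB : forall x y, W x -> W y -> W (x - y)).

Let WD x y : W x -> W y -> W (x + y).
Proof.
by move=> wx wy; rewrite -[y]opprK -[- y]sub0r; apply: (WB) => //; exact: WB.
Qed.

(** The values of [tau] on the generators are extended by means of the coordinates. It serves with W
    = 2Q, to lift maps known modulo 2, and with W a kernel, to split surjections. *)
Lemma R_lift (tau : P -> X) : coordinatized P ->
  (forall a x y, W (tau (a%:A *: x + y) - (a%:A *: tau x + tau y))) ->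
  exists2 th, R_linear th & forall x, W (th x - tau x).
Proof.
move=> [I [c [m [cL mE]]]] tauL.
exists (fun x => \sum_i R_lincomb (tau \o m i) (c i x)).
  move=> a x y; rewrite scaler_sumr -big_split; apply: eq_bigr => i _.
  by rewrite cL R_lincombP.
have tau0 : W (tau 0).
  have := tauL 1 0 0; rewrite !scale1r !addr0.
  have -> : tau 0 - (tau 0 + tau 0) = 0 - tau 0 by abel.
  by move=> h; rewrite -[tau 0](subKr 0); apply: (WB).
have tausum (J : Type) (r : seq J) (F : J -> P) (F' : J -> X) :
    (forall j, W (F' j - tau (F j))) ->
    W (\sum_(j <- r) F' j - tau (\sum_(j <- r) F j)).
  move=> FF; elim: r => [|j r IH]; first by rewrite !big_nil; exact: WB.
  rewrite !big_cons; have := tauL 1 (F j) (\sum_(j <- r) F j).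
  rewrite !scale1r; set u := tau (_ + _); set v := tau (\sum_(j <- r) _) in IH *.
  have -> : F' j + \sum_(j <- r) F' j - u =
     (F' j - tau (F j)) + (\sum_(j <- r) F' j - v) - (u - (tau (F j) + v)) by abel.
  by move=> h; apply: (WB) => //; apply: WD.
move=> x; rewrite {2}[x]mE; apply: (tausum) => i.
rewrite !(R_lincombE _ (leqnn _)); apply: (tausum) => n /=.
have := tauL (c i x)`_n (m i n) 0; rewrite addr0.
set u := tau (_ *: _); set v := _ *: _.
have -> : v - u = 0 - (u - (v + tau 0)) - tau 0 by abel.
by move=> h; apply: (WB) => //; apply: (WB).
Qed.
End Lifting.

End GroupRingZ2.

(** * Bases over F_2 *)

Lemma countable_enum (T : Type) (x0 : T) : countable_type T ->
  exists v : nat -> T, forall x, exists n, v n = x.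
Proof.
move=> [f finj]; have /choice [v vP] : forall n, exists x, forall y, f y = n -> x = y.
  move=> n; have [[x fx]|nx] := pselect (exists x, f x = n).
    by exists x => y fy; apply: finj; rewrite fx fy.
  by exists x0 => y fy; case: nx; exists y.
by exists v => x; exists (f x); exact: vP.
Qed.

Section IntegerCombinations.
Variables (V : zmodType) (v : nat -> V).

(** Polynomials serve as finitely supported integer sequences; modulo a subgroup that contains the
    doubles of the [v n], only the parity of the coefficients matters. *)
Definition icomb (c : {poly int}) : V := \sum_(i < size c) v i *~ c`_i.

Lemma icombE N (c : {poly int}) : (size c <= N)%N -> icomb c = \sum_(i < N) v i *~ c`_i.
Proof.
move=> cN; rewrite /icomb (big_ord_widen N (fun i => v i *~ c`_i) cN).
rewrite big_mkcond; apply: eq_bigr => i _; case: ltnP => // /(nth_default 0) ->.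
by rewrite mulr0z.
Qed.

Lemma icombD (c d : {poly int}) : icomb (c + d) = icomb c + icomb d.
Proof.
set N := maxn (size c) (size d).
have cN : (size c <= N)%N by rewrite leq_maxl.
have dN : (size d <= N)%N by rewrite leq_maxr.
have eN : (size (c + d)%R <= N)%N by rewrite (leq_trans (size_polyD _ _)).
rewrite !(icombE (N := N)) // -big_split; apply: eq_bigr => i _.
by rewrite coefD mulrzDr.
Qed.

Lemma icomb0 : icomb 0 = 0.
Proof. by rewrite /icomb size_poly0 big_ord0. Qed.

Lemma icombN c : icomb (- c) = - icomb c.
Proof. by apply: (addrI (icomb c)); rewrite -icombD !subrr icomb0. Qed.

Lemma icombMz c k : icomb (c *~ k) = icomb c *~ k.
Proof.
have icombMn n : icomb (c *+ n) = icomb c *+ n.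
  by elim: n => [|n IH]; rewrite ?mulr0n ?icomb0 // !mulrS icombD IH.
by case: k => n; rewrite ?NegzE ?mulrNz ?icombN -?pmulrn icombMn.
Qed.

Definition sub_closed (B : V -> Prop) := B 0 /\ forall x y, B x -> B y -> B (x - y).

Section SubClosed.
Variable B : V -> Prop.
Hypothesis BP : sub_closed B.

Lemma sub_closedN x : B x -> B (- x).
Proof. by case: BP => B0 BB; rewrite -[- x]sub0r; exact: BB. Qed.

Lemma sub_closedD x y : B x -> B y -> B (x + y).
Proof.
by move=> bx bY; rewrite -[y]opprK; case: BP => _; apply => //; exact: sub_closedN.
Qed.

Lemma sub_closedMz x (k : int) : B x -> B (x *~ k).
Proof.
move=> bx; have BMn n : B (x *+ n).
  elim: n => [|n IH]; first by case: BP.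
  by rewrite mulrS; apply: sub_closedD.
case: k => n; first exact: BMn.
by rewrite NegzE mulrNz; apply: sub_closedN; exact: BMn.
Qed.

Lemma sub_closed_sum (I : Type) (r : seq I) (F : I -> V) :
  (forall i, B (F i)) -> B (\sum_(i <- r) F i).
Proof.
by move=> BF; apply: big_ind => //; [case: BP|exact: sub_closedD].
Qed.

Definition icomb_supp (J : pred nat) (c : {poly int}) := forall i, ~~ J i -> c`_i = 0.

(* A greedy choice of a basis of the span of v in the F_2-vector space V / B. *)
Lemma F2_basis : (forall n, B (v n *+ 2)) ->
  exists J : pred nat,
    (forall n, exists2 c, icomb_supp J c & B (v n - icomb c)) /\
    (forall c, icomb_supp J c -> B (icomb c) -> exists d, c = d *+ 2).
Proof.
move=> v2; have [B0 BB] := BP.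
pose J n := `[< ~ exists c : nat -> int, B (v n - \sum_(i < n) v i *~ c i) >].
exists J; split.
- have span n (c : nat -> int) : exists c' : nat -> int,
      (forall i, ~~ J i -> c' i = 0) /\
      B (\sum_(i < n) v i *~ c i - \sum_(i < n) v i *~ c' i).
    elim: n c => [|n IH] c; first by exists (fun=> 0); rewrite !big_ord0 subrr.
    have [Jn|nJn] := boolP (J n).
      have [c' [c'J c'B]] := IH c; exists (fun i => if i == n then c n else c' i).
      split=> [i|]; first by case: eqVneq => [->|_]; [rewrite Jn|exact: c'J].
      rewrite !big_ord_recr /= eqxx /=.
      have -> : \sum_(i < n) v i *~ (if i == n :> nat then c n else c' i) =
          \sum_(i < n) v i *~ c' i.
        by apply: eq_bigr => i _; rewrite ltn_eqF.
      rewrite (_ : _ - _ = \sum_(i < n) v i *~ c i - \sum_(i < n) v i *~ c' i) //.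
      by set a := \sum_(i < n) v i *~ c i; set b := \sum_(i < n) _; abel.
    have [d dB] : exists c : nat -> int, B (v n - \sum_(i < n) v i *~ c i).
      by apply: contrapT => h; move/negP: nJn; apply; apply/asboolP.
    have [c' [c'J c'B]] := IH (fun i => c i + d i * c n); exists c'; split=> //.
    rewrite !big_ord_recr /=.
    have [Jn|] := boolP (J n); first by rewrite Jn in nJn.
    move=> /c'J ->; rewrite mulr0z addr0.
    have := sub_closedD c'B (sub_closedMz (c n) dB).
    rewrite mulrzBl mulrz_suml.
    rewrite (eq_bigr (fun i : 'I_n => v i *~ c i + v i *~ d i *~ c n)); last first.
      by move=> i _; rewrite mulrzDr mulrzA.
    rewrite big_split /=.
    set a := \sum_(i < n) _ *~ c i; set b := \sum_(i < n) _ *~ _ *~ _.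
    set e := \sum_(i < n) _; set z := v n *~ _.
    by have -> : a + b - e + (z - b) = a + z - e by abel.
  move=> n; have [c [cJ cB]] := span n.+1 (fun i => (i == n)%:Z).
  exists (\poly_(i < n.+1) c i).
    by move=> i /cJ ci; rewrite coef_poly ci if_same.
  rewrite (icombE (size_poly _ _)); move: cB; rewrite big_ord_recr /= eqxx.
  rewrite big1 ?add0r; last by move=> i _; rewrite ltn_eqF.
  rewrite (_ : \sum_(i < n.+1) v i *~ (\poly_(i0 < n.+1) c i0)`_i =
    \sum_(i < n.+1) v i *~ c i) //.
  by apply: eq_bigr => i _; rewrite coef_poly ltn_ord.
have indep n (c : nat -> int) : (forall i, ~~ J i -> c i = 0) ->
    B (\sum_(i < n) v i *~ c i) -> forall i, (i < n)%N -> exists d, c i = d *+ 2.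
  elim: n c => // n IH c cJ; rewrite big_ord_recr /= => cB i.
  have [d Dd] : exists d, c n = d *+ 2.
    have [Jn|/cJ ->] := boolP (J n); last by exists 0.
    have [d [->|Dd]] := int_parity (c n); first by exists d.
    move/asboolP: Jn => -[]; exists (fun i => - c i).
    rewrite (eq_bigr (fun i : 'I_n => - (v i *~ c i))); last first.
      by move=> j _; rewrite mulrNz.
    rewrite sumrN opprK; have := BB _ _ cB (sub_closedMz d (v2 n)).
    rewrite Dd mulrzDr mulr1z -[d *+ 2]mulr_natl mulrzA.
    rewrite -[v n *~ 2%:R]/(v n *+ 2).
    set a := \sum_(j < n) _; set b := _ *~ d.
    by have -> : a + (b + v n) - b = v n + a by abel.
  rewrite ltnS leq_eqVlt => /orP [/eqP ->|]; first by exists d.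
  apply: IH => //; have := BB _ _ cB (sub_closedMz d (v2 n)).
  by rewrite Dd -[d *+ 2]mulr_natl mulrzA -[v n *~ 2%:R]/(v n *+ 2) addrK.
move=> c cJ cB; have cE := indep _ _ cJ cB.
exists (\poly_(i < size c) (c`_i %/ 2)%Z); apply/polyP => i.
rewrite coefMn coef_poly; case: ltnP => [/cE [d ->]|/(nth_default 0) ->] //.
by have -> : ((d *+ 2) %/ 2)%Z = d by lia.
Qed.
End SubClosed.
End IntegerCombinations.

(** * Higman's criterion *)

Definition even_elt (V : zmodType) (x : V) := exists r, x = r *+ 2.

Lemma even_elt_closed (V : zmodType) : sub_closed (@even_elt V).
Proof.
split=> [|x y [r ->] [s ->]]; first by exists 0; rewrite mul0rn.
by exists (r - s); rewrite mulrnBl.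
Qed.

Lemma even_elt_eq (V : zmodType) (x y : V) : x = y -> even_elt x -> even_elt y.
Proof. by move->. Qed.

Lemma even_eltZ (A : comNzRingType) (V : lmodType A) (a : A) (x : V) :
  even_elt x -> even_elt (a *: x).
Proof. by move=> [r ->]; exists (a *: r); rewrite scalerMnr. Qed.

Section Higman.
Variable R : comNzRingType.
Local Notation A := (RZ2 R).
Local Notation Y := (YZ2 R).

Lemma scale_alg_intr (V : lmodType A) (c : int) (x : V) :
  (c%:~R : R)%:A *: x = x *~ c.
Proof.
by rewrite -[_%:A]/(in_alg A c%:~R) rmorph_int scaler_int.
Qed.

Lemma scale_algM (V : lmodType A) (a b : R) (x : V) :
  (a * b)%:A *: x = a%:A *: (b%:A *: x).
Proof. by rewrite scalerA -scalerAl mul1r scalerA. Qed.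

Lemma scale_alg_sum (V : lmodType A) (I : Type) (r : seq I) (F : I -> R) (x : V) :
  (\sum_(i <- r) F i)%:A *: x = \sum_(i <- r) (F i)%:A *: x.
Proof. by rewrite !scaler_suml. Qed.

Lemma scale_algB (V : lmodType A) (a b : R) (x : V) :
  (a - b)%:A *: x = a%:A *: x - b%:A *: x.
Proof. by rewrite !scalerBl. Qed.

Variable Q : lmodType A.
Hypotheses (Qcount : countable_type Q) (Qcoord : coordinatized Q).
Hypothesis torsion_free2 : forall x : Q, x *+ 2 = 0 -> x = 0.
Hypothesis tate_plus : forall x : Q, Y *: x = x -> exists w, x = w + Y *: w.
Hypothesis tate_minus : forall x : Q, Y *: x = - x -> exists w, x = w - Y *: w.

(** The intended [tr] is the trace of R over Z. The hypotheses say that the two components of [s]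
    are dual for the trace form modulo 2 and that [s] multiplies to 1: a separability idempotent of
    R/2R over F_2. *)
Variables (s : seq (R * R)) (tr : R -> int).
Hypothesis tr1 : forall a, even_elt (a - \sum_(t <- s) (tr (a * t.1))%:~R * t.2).
Hypothesis tr2 : forall a, even_elt (a - \sum_(t <- s) (tr (a * t.2))%:~R * t.1).
Hypothesis tr3 : even_elt (\sum_(t <- s) t.1 * t.2 - 1).

Local Notation ev := (@even_elt Q).
Let evP : sub_closed ev := @even_elt_closed Q.
Let evD x y : ev x -> ev y -> ev (x + y) := @sub_closedD _ _ evP x y.
Let evB x y : ev x -> ev y -> ev (x - y) := evP.2 x y.
Let evN x : ev x -> ev (- x) := @sub_closedN _ _ evP x.
Let evZ (a : A) (x : Q) : ev x -> ev (a *: x) := @even_eltZ _ Q a x.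
Let evsum := sub_closed_sum evP.

Let even_alg (a : R) (x : Q) : even_elt a -> ev (a%:A *: x).
Proof. by move=> [r ->]; exists (r%:A *: x); rewrite !scalerMnl. Qed.

Local Notation D x := (x + Y *: x).
Let B x := ev (D x).

Let DD (x y : Q) : D (x + y) = D x + D y.
Proof. by rewrite scalerDr; abel. Qed.

Let DN (x : Q) : D (- x) = - D x.
Proof. by rewrite scalerN; abel. Qed.

Let DB (x y : Q) : D (x - y) = D x - D y.
Proof. by rewrite DD DN. Qed.

Let DZ (a : A) (x : Q) : D (a *: x) = a *: D x.
Proof. by rewrite scalerDr YZ2_algC. Qed.

Let BP : sub_closed B.
Proof.
split=> [|x y]; first by exists 0; rewrite scaler0 addr0 mul0rn.
by rewrite /B DB => bx bY; apply: evB.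
Qed.

Let BZ (a : A) x : B x -> B (a *: x).
Proof. by rewrite /B DZ; exact: evZ. Qed.

Let evBsub x : ev x -> B x.
Proof. by move=> ex; apply: evD => //; exact: evZ. Qed.

(** On Q/2Q the kernel of 1 + Y is its image. If (1 + Y) x = 2 u, then u is Y-invariant, so u = (1 +
    Y) w by [tate_plus]; now 1 + Y kills x - 2 w, and [tate_minus] applies to it. *)
Let B_image x : B x -> exists z, ev (x - D z).
Proof.
move=> [u Du]; have uY : Y *: u = u.
  apply/eqP; rewrite -subr_eq0; apply/eqP; apply: torsion_free2.
  rewrite mulrnBl scalerMnr -Du scalerDr YZ2K; abel.
have [w Dw] := tate_plus uY.
have [v Dv] : exists v, x - w *+ 2 = v - Y *: v.
  apply: tate_minus; apply/eqP; rewrite -addr_eq0; apply/eqP.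
  have -> : Y *: (x - w *+ 2) + (x - w *+ 2) = D (x - w *+ 2) by abel.
  rewrite DB Du Dw -[w *+ 2]/(w + w) DD; abel.
exists v; exists (w - Y *: v).
have -> : x = x - w *+ 2 + w *+ 2 by rewrite subrK.
rewrite Dv; abel.
Qed.

(** An F_2-basis of Q modulo B is lifted to Q, and [rho0] sends x to its combination of basis
    vectors. Compatibility is stated for all integer relations at once, which gives additivity and
    the vanishing on B modulo 2. *)
Let rho0_exists : exists rho0 : Q -> Q,
  forall (I : Type) (r : seq I) (k : I -> int) (F : I -> Q),
    [/\ forall x, B (x - rho0 x) &
        B (\sum_(i <- r) F i *~ k i) -> ev (\sum_(i <- r) rho0 (F i) *~ k i)].
Proof.
have [v vP] := countable_enum (0 : Q) Qcount.
have v2 n : B (v n *+ 2) by apply: evBsub; exists (v n).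
have [J [Jspan Jind]] := F2_basis BP v2.
have /choice [c0 c0P] : forall x : Q, exists c, icomb_supp J c /\ B (x - icomb v c).
  by move=> x; have [n <-] := vP x; have [c cJ cB] := Jspan n; exists c.
exists (fun x => icomb v (c0 x)) => I r k F; split=> [x|FB]; first by case: (c0P x).
pose c := \sum_(i <- r) c0 (F i) *~ k i.
have cE : icomb v c = \sum_(i <- r) icomb v (c0 (F i)) *~ k i.
  rewrite /c (big_morph _ (icombD v) (icomb0 v)).
  by apply: eq_bigr => i _; rewrite icombMz.
rewrite -cE; have [||d ->] := Jind c.
- move=> j Jj; rewrite coef_sum big1 // => i _.
  have c0j : (c0 (F i))`_j = 0 by case: (c0P (F i)) => /(_ j Jj).
  by case: (k i) => m; rewrite ?NegzE ?mulrNz ?coefN -?pmulrn coefMn c0j mul0rn ?oppr0.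
- rewrite cE -[X in B X](subKr (\sum_(i <- r) F i *~ k i)).
  apply: BP.2 => //; rewrite -sumrB; apply: (sub_closed_sum BP) => i.
  by rewrite -mulrzBl; apply: (sub_closedMz BP); case: (c0P (F i)).
by rewrite mulr2n icombD; exists (icomb v d).
Qed.

(* A projection of Q / 2Q along the kernel of 1 + Y, linear modulo 2; the     *)
(* F_2-linear projection rho0 is averaged over the separability idempotent s. *)
Let rho_exists : exists rho : Q -> Q,
  [/\ forall (a : R) x y, ev (rho (a%:A *: x + y) - (a%:A *: rho x + rho y)),
      forall x, B x -> ev (rho x) & forall x, B (x - rho x)].
Proof.
have [rho0 rho0P] := rho0_exists.
have rho0B x : B (x - rho0 x) by case: (rho0P unit [::] (fun=> 0) (fun=> 0)).
have rho0_comb I r k F := (rho0P I r k F).2.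
have rho0D x y : ev (rho0 (x + y) - (rho0 x + rho0 y)).
  have := rho0_comb _ [:: (x + y, 1); (x, -1); (y, -1)] (fun p => p.2) (fun p => p.1).
  rewrite !big_cons !big_nil /= !mulr1z !mulrN1z !addr0 opprD; apply.
  have -> : x + y + (- x - y) = 0 by abel.
  by case: BP.
pose rho x := \sum_(t <- s) t.1%:A *: rho0 (t.2%:A *: x).
exists rho; split.
- move=> a x y.
  have rhoD : ev (rho (a%:A *: x + y) - (rho (a%:A *: x) + rho y)).
    rewrite /rho -big_split -sumrB; apply: evsum => t.
    rewrite /= -scalerDr -scalerBr; apply: evZ.
    by rewrite [X in rho0 X](scalerDr t.2%:A); exact: rho0D.
  suff rhoZ : ev (rho (a%:A *: x) - a%:A *: rho x).
    have := evD rhoD rhoZ; set u := rho _; set w := rho _; set z := _ *: _; set q := rho y.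
    by have -> : u - (w + q) + (w - z) = u - (z + q) by abel.
  (* Modulo 2, the products t.2 a have the coefficients C t t' in the t'.2 by [tr1], and the a t'.1
     have the same coefficients in the t.1 by [tr2]. Integers pass through [rho0], so the factor a
     moves from the second components of [s] to the first. *)
  pose C (t t' : R * R) := tr (a * t'.1 * t.2).
  have step1 : ev (rho (a%:A *: x) -
      \sum_(t <- s) \sum_(t' <- s) (t.1 * (C t t')%:~R)%:A *: rho0 (t'.2%:A *: x)).
    rewrite /rho -sumrB; apply: evsum => t.
    have -> : \sum_(t' <- s) (t.1 * (C t t')%:~R)%:A *: rho0 (t'.2%:A *: x) =
        t.1%:A *: \sum_(t' <- s) rho0 (t'.2%:A *: x) *~ C t t'.
      rewrite scaler_sumr; apply: eq_bigr => t' _.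
      by rewrite scale_algM scale_alg_intr.
    rewrite -scalerBr; apply: evZ.
    have := rho0_comb _ ((t.2%:A *: (a%:A *: x), 1) :: [seq (t'.2%:A *: x, - C t t') | t' <- s])
      (fun p => p.2) (fun p => p.1).
    rewrite !big_cons !big_map /= !mulr1z.
    have sumMzN (f : R * R -> Q) :
        \sum_(t' <- s) f t' *~ - C t t' = - \sum_(t' <- s) f t' *~ C t t'.
      by rewrite -sumrN; apply: eq_bigr => t' _; rewrite mulrNz.
    rewrite (sumMzN (fun t' => t'.2%:A *: x)) (sumMzN (fun t' => rho0 (t'.2%:A *: x))).
    apply; apply: evBsub.
    have := even_alg x (tr1 (t.2 * a)).
    rewrite scale_algB scale_alg_sum scale_algM.
    set u := \sum_(i <- s) _; set w := \sum_(i <- s) _.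
    suff -> : u = w by [].
    apply: eq_bigr => t' _; rewrite /C mulrAC [t.2 * a]mulrC.
    by rewrite scale_algM scale_alg_intr.
  have step2 : ev (\sum_(t' <- s) (\sum_(t <- s) t.1 * (C t t')%:~R)%:A *: rho0 (t'.2%:A *: x)
      - a%:A *: rho x).
    rewrite /rho scaler_sumr -sumrB; apply: evsum => t'.
    rewrite -scale_algM -scale_algB.
    apply: even_alg; have [r Dr] := tr2 (a * t'.1); exists (- r).
    rewrite mulNrn -Dr opprB; congr (_ - _).
    by apply: eq_bigr => t _; rewrite mulrC.
  have := evD step1 step2; rewrite exchange_big /=.
  rewrite (eq_bigr (fun t' => (\sum_(t <- s) t.1 * (C t t')%:~R)%:A *: rho0 (t'.2%:A *: x))).
    by rewrite addrA subrK.
  by move=> t' _; rewrite scale_alg_sum.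
- move=> x bx; apply: evsum => t; apply: evZ.
  have := rho0_comb _ [:: t.2%:A *: x] (fun=> 1) id.
  by rewrite !big_seq1 !mulr1z; apply; exact: BZ.
move=> x; rewrite /B DB.
have -> : D x - D (rho x) = (D x - \sum_(t <- s) (t.1 * t.2)%:A *: D x)
   + \sum_(t <- s) t.1%:A *: D (t.2%:A *: x - rho0 (t.2%:A *: x)).
  have -> : D (rho x) = \sum_(t <- s) t.1%:A *: D (rho0 (t.2%:A *: x)).
    rewrite /rho scaler_sumr -big_split; apply: eq_bigr => t _.
    by rewrite -DZ.
  rewrite -[RHS]addrA; congr (_ + _); rewrite -!sumrN -big_split /=.
  apply: eq_bigr => t _.
  by rewrite DB scalerBr DZ scale_algM; abel.
apply: evD; last first.
  by apply: evsum => t; apply: evZ; exact: rho0B.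
have := even_alg (D x) tr3.
rewrite scale_algB !scale1r scale_alg_sum => /evN.
by rewrite opprB.
Qed.

(** Modulo 2, Q is T + Y T for a complement T of the kernel of 1 + Y, and the projection to T
    satisfies the identity. It lifts to an R-linear map, whose error is divisible by 2 and can be
    removed. *)
Lemma higman : exists2 th : Q -> Q, R_linear th &
  forall x, th x + Y *: th (Y *: x) = x.
Proof.
have [rho [rhoL rho_B rho_id]] := rho_exists.
have rho_cong x y : B (x - y) -> ev (rho x - rho y).
  move=> /rho_B h; have := rhoL 1 (x - y) y; rewrite !scale1r subrK => h2.
  have := evD h2 h; set u := rho (x - y).
  by have -> : rho x - (u + rho y) + u = rho x - rho y by abel.
have /choice [z zP] : forall x, exists z, ev (x - rho x - D z).
  by move=> x; apply: B_image; exact: rho_id.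
have Dev x : ev (x - rho x - D (z x)) -> ev (D (z x) - (x - rho x)).
  by move=> /evN; rewrite opprB.
(* Modulo 2, x = t + (1 + Y) t' with t = [rho x] and t' = [rho (z x)] in T, hence x = (t + t') + Y
   t'. So [tau] is the component in T of the decomposition T + Y T. *)
pose tau x := rho x + rho (z x).
have tauL (a : R) x y : ev (tau (a%:A *: x + y) - (a%:A *: tau x + tau y)).
  have zL : B (z (a%:A *: x + y) - (a%:A *: z x + z y)).
    have := evB (evB (evB (evZ a%:A (zP x)) (evN (zP y))) (zP (a%:A *: x + y))) (rhoL a x y).
    rewrite /B !(scalerBr, scalerDr, scalerN) ![Y *: (a%:A *: _)]YZ2_algC.
    by apply: even_elt_eq; abel.
  have := evD (rhoL a x y) (evD (rho_cong _ _ zL) (rhoL a (z x) (z y))).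
  by rewrite /tau !(scalerBr, scalerDr, scalerN); apply: even_elt_eq; abel.
have [th thL thE] := R_lift evP.1 evP.2 Qcoord tauL.
have tauY x : ev (tau x + Y *: tau (Y *: x) - x).
  have h1 : ev (rho (Y *: x) - rho x).
    apply: rho_cong; rewrite /B DB YZ2K.
    have -> : Y *: x + x - D x = 0 by abel.
    exact: evP.1.
  have h2 : ev (rho (z (Y *: x)) - rho (z x + x)).
    apply: rho_cong; rewrite /B DB DD.
    have e : ev (x *+ 2) by exists x.
    have := evB (evD (evB (zP x) (zP (Y *: x))) (evN h1)) e.
    apply: even_elt_eq; abel.
  have h3 : ev (rho (z x + x) - (rho (z x) + rho x)).
    by have := rhoL 1 (z x) x; rewrite !scale1r.
  have h4 : ev (Y *: rho x *+ 2) by exists (Y *: rho x).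
  have h5 : ev (rho (z x) + Y *: rho (z x) - (x - rho x)).
    have := evD (rho_id (z x)) (zP x).
    move=> /evN; rewrite !(scalerBr, scalerDr, scalerN).
    by apply: even_elt_eq; abel.
  have := evD (evZ Y (evD h1 (evD h2 h3))) (evD h4 h5).
  rewrite /tau !(scalerBr, scalerDr, scalerN).
  by apply: even_elt_eq; abel.
have /choice [psi psiP] : forall x, exists r, th x + Y *: th (Y *: x) - x = r *+ 2.
  move=> x; have := evD (evD (thE x) (evZ Y (thE (Y *: x)))) (tauY x).
  rewrite !(scalerBr, scalerDr, scalerN).
  by apply: even_elt_eq; abel.
have inj2 (x y : Q) : x *+ 2 = y *+ 2 -> x = y.
  by move=> e; apply/eqP; rewrite -subr_eq0; apply/eqP/torsion_free2; rewrite mulrnBl e subrr.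
have psiL : R_linear psi.
  move=> a x y; apply: inj2; rewrite -psiP mulrnDl scalerMnr -!psiP.
  rewrite !(scalerBr, scalerDr, scalerN) YZ2_algC !thL.
  rewrite !(scalerBr, scalerDr, scalerN) ![Y *: (a%:A *: _)]YZ2_algC.
  abel.
have psiY x : psi (Y *: x) = Y *: psi x.
  apply: inj2; rewrite -psiP scalerMnr -psiP YZ2K.
  rewrite !(scalerBr, scalerDr, scalerN) YZ2K.
  abel.
(* As [psi] commutes with Y, it contributes psi x + Y psi (Y x) = 2 psi x, which is exactly the
   error of [th]. *)
exists (fun x => th x - psi x) => [a x y|x].
  by rewrite thL psiL !(scalerBr, scalerDr, scalerN); abel.
rewrite psiY !(scalerBr, scalerDr, scalerN) YZ2K.
have -> : Y *: th (Y *: x) = psi x *+ 2 + x - th x by rewrite -psiP; abel.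
abel.
Qed.
End Higman.

(** * Isomorphisms and the swindle *)

Definition mk_linear (A : nzRingType) (U V : lmodType A) (f : U -> V) (fL : linear f) :
  {linear U -> V} := HB.pack f (GRing.isLinear.Build A U V *:%R f fL).

Section KernelModule.
Variables (A : nzRingType) (E N : lmodType A) (pi : {linear E -> N}).

Definition ker_pred : {pred E} := fun x => pi x == 0.

Fact ker_submod : submod_closed ker_pred.
Proof.
split=> [|a x y]; rewrite !unfold_in; first by rewrite linear0.
by move=> /eqP px /eqP py; rewrite linearP px py scaler0 addr0.
Qed.

HB.instance Definition _ := GRing.isSubmodClosed.Build A E ker_pred ker_submod.

Record ker_module := KerModule { ker_val :> E; _ : ker_val \in ker_pred }.

HB.instance Definition _ := [isSub for ker_val].
HB.instance Definition _ := [Choice of ker_module by <:].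
HB.instance Definition _ := [SubChoice_isSubLmodule of ker_module by <:].

Lemma ker_valP (x : ker_module) : pi (ker_val x) = 0.
Proof. by apply/eqP; case: x. Qed.

Lemma ker_exists (x : E) : pi x = 0 -> exists z : ker_module, ker_val z = x.
Proof. by move=> /eqP px; exists (@KerModule x px). Qed.
End KernelModule.

Section ModuleIsomorphisms.
Variable A : comNzRingType.
Local Notation L := (dsum_inf A).

Lemma mod_iso_can (U V : lmodType A) (f : {linear U -> V}) (g : V -> U) :
  cancel f g -> cancel g f -> mod_iso U V.
Proof. by move=> fK gK; exists f, g. Qed.

Lemma mod_iso_sym (U V : lmodType A) : mod_iso U V -> mod_iso V U.
Proof.
move=> [f [g fK gK]].
have gL : linear g by move=> a x y; apply: (can_inj fK); rewrite linearP !gK.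
exact: (@mod_iso_can _ _ (mk_linear gL) f).
Qed.

Lemma mod_iso_trans (U V W : lmodType A) : mod_iso U V -> mod_iso V W -> mod_iso U W.
Proof. by move=> [f fb] [g gb]; exists (g \o f); exact: bij_comp. Qed.

Lemma mod_iso_prod (U U' V V' : lmodType A) :
  mod_iso U U' -> mod_iso V V' -> mod_iso (U * V)%type (U' * V')%type.
Proof.
move=> [f [f' fK f'K]] [g [g' gK g'K]].
have hL : linear (fun x : U * V => (f x.1, g x.2) : U' * V').
  by move=> a x y /=; rewrite !linearP.
apply: (@mod_iso_can _ _ (mk_linear hL) (fun y => (f' y.1, g' y.2))).
  by move=> [x y] /=; rewrite fK gK.
by move=> [x y] /=; rewrite f'K g'K.
Qed.

Lemma mod_iso_refl (U : lmodType A) : mod_iso U U.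
Proof. exact: (@mod_iso_can _ _ idfun id). Qed.

Lemma mod_isoA (U V W : lmodType A) :
  mod_iso (U * V * W)%type (U * (V * W))%type.
Proof.
have hL : linear (fun x : U * V * W => (x.1.1, (x.1.2, x.2)) : U * (V * W)) by [].
apply: (@mod_iso_can _ _ (mk_linear hL) (fun y => (y.1, y.2.1, y.2.2))).
  by move=> [[x y] z].
by move=> [x [y z]].
Qed.

Lemma mod_isoC (U V : lmodType A) : mod_iso (U * V)%type (V * U)%type.
Proof.
have hL : linear (fun x : U * V => (x.2, x.1) : V * U) by [].
by apply: (@mod_iso_can _ _ (mk_linear hL) (fun y => (y.2, y.1))) => -[].
Qed.

Lemma split_surjection (E N : lmodType A) (pi : {linear E -> N})
    (ret : {linear E -> ker_module pi}) :
  (forall v, exists u, pi u = v) -> (forall z, ret (ker_val z) = z) ->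
  mod_iso E (ker_module pi * N)%type.
Proof.
move=> pi_surj retK.
have hL : linear (fun x => (ret x, pi x) : ker_module pi * N).
  by move=> a x y; rewrite !linearP.
have h_inj : injective (mk_linear hL).
  move=> x y [rxy pxy]; have [z Dz] : exists z : ker_module pi, ker_val z = x - y.
    by apply: ker_exists; rewrite linearB pxy subrr.
  apply/eqP; rewrite -subr_eq0 -Dz -[z]retK Dz linearB rxy subrr.
  by rewrite -[ker_val _]/(\val _) raddf0.
have /choice [h' h'K] : forall y, exists x, mk_linear hL x = y.
  move=> [z v]; have [u Du] := pi_surj v.
  exists (u - ker_val (ret u) + ker_val z) => /=.
  by rewrite linearD linearB !retK subrr add0r linearD linearB !ker_valP subr0 addr0 Du.
by apply: (@mod_iso_can _ _ _ h') => // x; apply: h_inj; rewrite h'K.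
Qed.

Let lcL (m : nat -> L) : {linear L -> L} := @lincomb A (dsum_inf A : lmodType A) m.
Let lcLX (m : nat -> L) n : lcL m 'X^n = m n.
Proof. exact: (@lincombXn A (dsum_inf A : lmodType A)). Qed.

Let pr n m := Cantor.to_nat (n, m).
Let pr1 k := (Cantor.of_nat k).1.
Let pr2 k := (Cantor.of_nat k).2.
Let pr1K n m : pr1 (pr n m) = n. Proof. by rewrite /pr1 Cantor.cancel_of_to. Qed.
Let pr2K n m : pr2 (pr n m) = m. Proof. by rewrite /pr2 Cantor.cancel_of_to. Qed.
Let prK k : pr (pr1 k) (pr2 k) = k.
Proof. by rewrite /pr /pr1 /pr2 -surjective_pairing Cantor.cancel_to_of. Qed.

Lemma dsum_inf_ext (V : lmodType A) (f g : {linear L -> V}) :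
  (forall n, f 'X^n = g 'X^n) -> f =1 g.
Proof.
move=> fg l; rewrite [l](_ : _ = \sum_(i < size (l : {poly A})) l`_i *: 'X^i).
  by rewrite !linear_sum; apply: eq_bigr => i _; rewrite !linearZ fg.
by rewrite -poly_def coefK.
Qed.

(* Eilenberg's swindle: L is a sum of countably many rows, each isomorphic to *)
(* L = Q + Q', and E projects every row to its summand Q; S shifts the rows.  *)
Lemma swindle (Q : lmodType A) (i : {linear Q -> L}) (p : {linear L -> Q}) :
  cancel i p -> mod_iso (Q * L)%type L.
Proof.
move=> iK.
pose row n : {linear L -> L} := lcL (fun m => 'X^(pr n m) : L).
pose row0' : {linear L -> L} :=
  lcL (fun k => (if pr1 k == 0%N then 'X^(pr2 k) else 0) : L).
pose E : {linear L -> L} :=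
  lcL (fun k => row (pr1 k) (i (p ('X^(pr2 k)))) : L).
pose S : {linear L -> L} := lcL (fun k => 'X^(pr (pr1 k).+1 (pr2 k)) : L).
pose T : {linear L -> L} :=
  lcL (fun k => (if pr1 k is n.+1 then 'X^(pr n (pr2 k)) else 0) : L).
have rowX n m : row n 'X^m = 'X^(pr n m) by exact: lcLX.
have row0'X n m : row0' 'X^(pr n m) = if n == 0%N then 'X^m else 0.
  by rewrite /row0' lcLX pr1K pr2K.
have EX n m : E 'X^(pr n m) = row n (i (p 'X^m)).
  by rewrite /E lcLX pr1K pr2K.
have SX n m : S 'X^(pr n m) = 'X^(pr n.+1 m) by rewrite /S lcLX pr1K pr2K.
have TX n m : T 'X^(pr n m) = if n is n'.+1 then 'X^(pr n' m) else 0.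
  by rewrite /T lcLX pr1K pr2K.
clearbody row row0' E S T.
have extpr (V : lmodType A) (f g : {linear L -> V}) :
    (forall n m, f 'X^(pr n m) = g 'X^(pr n m)) -> f =1 g.
  by move=> fg; apply: dsum_inf_ext => k; rewrite -(prK k).
have Erow n l : E (row n l) = row n (i (p l)).
  apply: (dsum_inf_ext (f := E \o row n) (g := row n \o i \o p)) => m.
  by rewrite /= rowX EX.
have Srow n l : S (row n l) = row n.+1 l.
  by apply: (dsum_inf_ext (f := S \o row n) (g := row n.+1)) => m; rewrite /= !rowX SX.
have Trow n l : T (row n.+1 l) = row n l.
  by apply: (dsum_inf_ext (f := T \o row n.+1) (g := row n)) => m; rewrite /= !rowX TX.
have Trow0 l : T (row 0%N l) = 0.
  by apply: (dsum_inf_ext (f := T \o row 0%N) (g := \0)) => m; rewrite /= rowX TX.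
have row0'row n l : row0' (row n l) = if n == 0%N then l else 0.
  case: eqP => n0.
    by apply: (dsum_inf_ext (f := row0' \o row n) (g := idfun)) => m; rewrite /= rowX row0'X n0.
  by apply: (dsum_inf_ext (f := row0' \o row n) (g := \0)) => m; rewrite /= rowX row0'X; case: eqP.
have EE l : E (E l) = E l.
  apply: (extpr _ (E \o E) E) => n m.
  by rewrite /= EX Erow iK.
have ES l : E (S l) = S (E l).
  apply: (extpr _ (E \o S) (S \o E)) => n m.
  by rewrite /= SX !EX Srow.
have TS l : T (S l) = l.
  by apply: (extpr _ (T \o S) idfun) => n m; rewrite /= SX TX.
have ET l : E (T l) = T (E l).
  apply: (extpr _ (E \o T) (T \o E)) => -[|n] m; rewrite /= TX EX.
    by rewrite linear0 Trow0.
  by rewrite EX Trow.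
have ST l : S (T l) = l - row 0%N (row0' l).
  have := extpr _ (S \o T) (idfun \- (row 0%N \o row0')) _ l; apply=> -[|n] m.
    by rewrite /= TX row0'X rowX linear0 subrr.
  by rewrite /= TX row0'X SX linear0 subr0.
have row0'E l : row0' (E l) = i (p (row0' l)).
  apply: (extpr _ (row0' \o E) (i \o p \o row0')) => n m.
  by rewrite /= EX row0'row row0'X; case: eqP; rewrite // !linear0.
have row0'S l : row0' (S l) = 0.
  by apply: (extpr _ (row0' \o S) \0) => n m; rewrite /= SX row0'X.
(* The Q-part of every row moves to the next row, the Q'-parts stay, and the vacated Q-part of row 0
   receives the element of Q. The inverse is [H]. *)
have FL : linear (fun x : Q * L => x.2 - E x.2 + S (E x.2) + row 0%N (i x.1) : L).
  move=> a x y; rewrite !linearP /= !scalerDr scalerN; abel.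
pose F := mk_linear FL.
pose H (l : L) : Q * L := (p (row0' l), l - E l + T (E l)).
apply: (@mod_iso_can _ _ F H).
  move=> [q l]; rewrite /H /F /=; congr pair.
    rewrite !linearD !linearN /= row0'E row0'S row0'row /= linear0 addr0.
    by rewrite !iK subrr add0r.
  rewrite !linearD !linearN /= !EE !ES !EE !Erow iK !TS Trow0.
  by abel.
move=> l; rewrite /F /H /= !linearD !linearN /= !ET !EE !ST row0'E.
by abel.
Qed.

End ModuleIsomorphisms.

(** * Tate cohomology and stable equivalence *)

Section TateMaps.
Variables (A : comNzRingType) (E N : lmodType A) (pi : {linear E -> N}).

(* For an involution e of A, the kernel of 1 - e modulo the image of 1 + e is *)
(* a Tate cohomology group of Z/2Z.                                           *)
Definition tate_inj (e : A) := forall x, e *: x = x ->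
  forall w, pi x = w + e *: w -> exists u, x = u + e *: u.

Definition tate_surj (e : A) := forall w, e *: w = w ->
  exists u v, e *: u = u /\ w = pi u + (v + e *: v).

(** This is a piece of the long exact sequence of Tate groups. Injectivity gives z = u + e u in E.
    Then pi u is fixed by -e, so by surjectivity it comes from a (-e)-invariant u' up to some v - e
    v. Subtracting u' and a lift of v - e v from u gives an element of the kernel with the same norm
    z. *)
Lemma tate_kernel (e : A) : e * e = 1 -> (forall v, exists u, pi u = v) ->
  tate_inj e -> tate_surj (- e) ->
  forall z : ker_module pi, e *: z = z -> exists z', z = z' + e *: z'.
Proof.
move=> ee pi_surj inj_e surj_e z ez.
have ez' : e *: ker_val z = ker_val z by rewrite -[in RHS]ez.
have [|u Du] := inj_e _ ez' 0; first by rewrite ker_valP scaler0 addr0.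
have [|u' [v [eu' Dv]]] := surj_e (pi u).
  rewrite scaleNr -linearZ /=; apply/eqP; rewrite eq_sym -addr_eq0 -linearD -Du.
  by rewrite ker_valP.
have [t Dt] := pi_surj v.
have [|z' Dz'] := @ker_exists _ _ _ pi (u - u' - (t - e *: t)).
  by rewrite !linearB linearZ /= Dt Dv scaleNr; abel.
exists z'; apply: val_inj => /=; rewrite -[LHS]/(ker_val z) Du.
rewrite -[RHS]/(ker_val z' + e *: ker_val z') Dz' !scalerBr scalerA ee scale1r.
have -> : e *: u' = - u' by rewrite -[in RHS]eu' scaleNr opprK.
abel.
Qed.
End TateMaps.

Section StableEquivalence.
Variable R : comNzRingType.
Local Notation A := (RZ2 R).
Local Notation Y := (YZ2 R).
Local Notation L := (dsum_inf (RZ2 R)).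
Variables (E N : lmodType A) (pi : {linear E -> N}).
Hypothesis pi_surj : forall v, exists u, pi u = v.
Hypotheses (Ecount : countable_type E) (Ecoord : coordinatized E).
Hypothesis Ncoord : coordinatized N.
Hypothesis torsion_free2 : forall x : E, x *+ 2 = 0 -> x = 0.
Hypotheses (injY : tate_inj pi Y) (surjY : tate_surj pi Y).
Hypotheses (injNY : tate_inj pi (- Y)) (surjNY : tate_surj pi (- Y)).
Variables (s : seq (R * R)) (tr : R -> int).
Hypothesis tr1 : forall a, even_elt (a - \sum_(t <- s) (tr (a * t.1))%:~R * t.2).
Hypothesis tr2 : forall a, even_elt (a - \sum_(t <- s) (tr (a * t.2))%:~R * t.1).
Hypothesis tr3 : even_elt (\sum_(t <- s) t.1 * t.2 - 1).
Local Notation Q := (ker_module pi).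

Lemma R_section (P X : lmodType A) (p : {linear X -> P}) : coordinatized P ->
  (forall v, exists u, p u = v) -> exists2 sg : P -> X, R_linear sg & cancel sg p.
Proof.
move=> Pc /choice [tau tauK].
have [|x y px py|a x y|sg sgL sgE] := @R_lift _ P X (fun x => p x = 0) _ _ tau Pc.
- exact: linear0.
- by rewrite linearB px py subrr.
- by rewrite linearB linearP !tauK subrr.
exists sg => // x; have := sgE x; rewrite linearB tauK => /eqP.
by rewrite subr_eq0 => /eqP.
Qed.

(** With [th] from [higman], an R-linear map f into or out of Q becomes A-linear by averaging, and
    retractions remain retractions. So the R-splittings of E -> N and of L -> Q become A-splittings:
    E = Q + N, and Q is a summand of L, whence Q + L = L by the swindle. *)
Lemma stable_equivalence : mod_iso (N * L)%type (E * L)%type.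
Proof.
have [sg sgL sgK] := R_section Ncoord pi_surj.
have /choice [k0 k0E] : forall x, exists z : Q, ker_val z = x - sg (pi x).
  by move=> x; apply: ker_exists; rewrite linearB sgK subrr.
have valB (x y : Q) : ker_val (x - y) = ker_val x - ker_val y by [].
have valI : injective (@ker_val _ _ _ pi) by exact: val_inj.
have k0L : R_linear k0.
  move=> a x y; apply: valI; rewrite k0E.
  rewrite -[RHS]/(a%:A *: ker_val (k0 x) + ker_val (k0 y)) !k0E linearP sgL.
  by rewrite scalerBr; abel.
have k0K z : k0 (ker_val z) = z.
  by apply: valI; rewrite k0E ker_valP (R_linear0 sgL) subr0.
have Qcoord : coordinatized Q.
  have [I [c [m [cL mE]]]] := Ecoord.
  exists I, (fun i z => c i (ker_val z)), (fun i n => k0 (m i n)); split.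
    by move=> i a x y; rewrite -cL.
  move=> z; rewrite -{1}[z]k0K {1}[ker_val z]mE (R_linear_sum k0L).
  apply: eq_bigr => i _; rewrite !(R_lincombE _ (leqnn _)) (R_linear_sum k0L).
  by apply: eq_bigr => n _; rewrite (R_linearZ k0L).
have Qcount : countable_type Q.
  by have [f finj] := Ecount; exists (f \o @ker_val _ _ _ pi); apply: inj_comp.
have Qtf (x : Q) : x *+ 2 = 0 -> x = 0.
  move=> x2; apply: valI; apply: torsion_free2.
  by rewrite -[LHS]/(ker_val (x *+ 2)) x2.
have tateP (x : Q) : Y *: x = x -> exists w, x = w + Y *: w.
  exact: (tate_kernel (YZ2_sqr R) pi_surj).
have tateM (x : Q) : Y *: x = - x -> exists w, x = w - Y *: w.
  move=> yx; have [|||w ->] := @tate_kernel _ _ _ pi (- Y) _ pi_surj injNY _ x.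
  - by rewrite mulrNN YZ2_sqr.
  - by rewrite opprK.
  - by rewrite scaleNr yx opprK.
  by exists w; rewrite scaleNr.
have [th thL thE] := higman Qcount Qcoord Qtf tateP tateM tr1 tr2 tr3.
have retL : linear (fun x => th (k0 x) + Y *: th (k0 (Y *: x))).
  apply: R_linear_A => [a x y|x].
    by rewrite scalerDr YZ2_algC k0L thL k0L thL !scalerDr YZ2_algC; abel.
  by rewrite YZ2K scalerDr YZ2K; abel.
have EQN : mod_iso E (Q * N)%type.
  apply: (@split_surjection _ _ _ pi (mk_linear retL)) => // z /=.
  by rewrite -[Y *: ker_val z]/(ker_val (Y *: z)) !k0K thE.
have QLL : mod_iso (Q * L)%type L.
  have [v vP] := countable_enum (0 : Q) Qcount.
  pose p : {linear L -> Q} := lincomb v.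
  have [|j jL jK] := @R_section Q L p Qcoord.
    by move=> z; have [n <-] := vP z; exists 'X^n; exact: lincombXn.
  have iL : linear (fun z => j (th z) + Y *: j (th (Y *: z))).
    apply: R_linear_A => [a x y|x].
      by rewrite scalerDr YZ2_algC !thL !jL !scalerDr YZ2_algC; abel.
    by rewrite YZ2K scalerDr YZ2K; abel.
  apply: (@swindle _ _ (mk_linear iL) p) => z /=.
  by rewrite linearD linearZ /= !jK.
apply: mod_iso_trans (mod_iso_prod (mod_iso_refl N) (mod_iso_sym QLL)) _.
apply: mod_iso_trans (mod_iso_sym (mod_isoA _ _ _)) _.
apply: mod_iso_prod; last exact: mod_iso_refl.
apply: mod_iso_trans (mod_isoC _ _) _; exact: mod_iso_sym.
Qed.
End StableEquivalence.

(** * Modules on which Y acts by a sign *)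

Section CountableTypes.

Lemma countable_type_inj (T U : Type) (f : T -> U) :
  injective f -> countable_type U -> countable_type T.
Proof. by move=> fI [g gI]; exists (g \o f); exact: inj_comp. Qed.

Lemma countable_type_prod (T U : Type) :
  countable_type T -> countable_type U -> countable_type (T * U).
Proof.
move=> [f fI] [g gI]; exists (fun x => pickle (f x.1, g x.2)) => -[x y] [x' y'].
by move=> /(pcan_inj pickleK) [/fI -> /gI ->].
Qed.

Lemma countable_type_poly (A : nzRingType) : countable_type A -> countable_type {poly A}.
Proof.
move=> [f fI]; exists (fun p : {poly A} => pickle (map f p)) => p q.
by move=> /(pcan_inj pickleK) /(inj_map fI) /poly_inj.
Qed.

Lemma countable_type_ffun (I : finType) (T : Type) :
  countable_type T -> countable_type {ffun I -> T}.
Proof.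
move=> [f fI]; exists (fun u : {ffun I -> T} => pickle [ffun i => f (u i)]) => u v.
move=> /(pcan_inj pickleK) /ffunP uv; apply/ffunP => i.
by have := uv i; rewrite !ffunE => /fI.
Qed.
End CountableTypes.

Section SignModules.
Variable R : comNzRingType.
Local Notation A := (RZ2 R).
Local Notation Y := (YZ2 R).

Lemma RZ2_coef0 (a b : R) : (a%:A + b%:A * Y : A)`_0 = a.
Proof.
have -> : b%:A * Y = b *: Y by rewrite -scalerAl mul1r.
rewrite -[LHS]/((a *: (1 : {poly R}) + b *: (Y : {poly R}))`_0) YZ2E.
by rewrite coefD !coefZ coef1 coefX mulr1 mulr0 addr0.
Qed.

Lemma RZ2_coef1 (a b : R) : (a%:A + b%:A * Y : A)`_1 = b.
Proof.
have -> : b%:A * Y = b *: Y by rewrite -scalerAl mul1r.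
rewrite -[LHS]/((a *: (1 : {poly R}) + b *: (Y : {poly R}))`_1) YZ2E.
by rewrite coefD !coefZ coef1 coefX mulr1 mulr0 add0r.
Qed.

(** This is the R-algebra map A -> R with Y |-> (-1)^b, along which free R-modules become
    A-modules. *)
Definition sgn_eval (b : bool) (z : A) : R := z`_0 + (-1) ^+ b * z`_1.

Lemma sgn_eval_zmod b : zmod_morphism (sgn_eval b).
Proof.
move=> x y; rewrite /sgn_eval.
rewrite -[(x - y)`_0]/(((x : {poly R}) - (y : {poly R}))`_0).
rewrite -[(x - y)`_1]/(((x : {poly R}) - (y : {poly R}))`_1).
by rewrite !coefB; ring.
Qed.

Lemma sgn_evalE b (p q : R) : sgn_eval b (p%:A + q%:A * Y) = p + (-1) ^+ b * q.
Proof. by rewrite /sgn_eval RZ2_coef0 RZ2_coef1. Qed.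

Lemma sgn_eval_monoid b : monoid_morphism (sgn_eval b).
Proof.
split.
  have -> : (1 : A) = 1%:A + 0%:A * Y by rewrite scale1r scale0r mul0r addr0.
  by rewrite sgn_evalE mulr0 addr0.
move=> x y; rewrite [x]RZ2_XE [y]RZ2_XE.
move: (x`_0) (x`_1) (y`_0) (y`_1) => p q r t.
have -> : (p%:A + q%:A * Y) * (r%:A + t%:A * Y) =
    (p * r + q * t)%:A + (p * t + q * r)%:A * Y :> A.
  have algD u v : (u + v)%:A = u%:A + v%:A :> A by rewrite scalerDl.
  have algM u v : (u * v)%:A = u%:A * v%:A :> A by rewrite -scalerAl mul1r scalerA.
  rewrite !algD !algM.
  move: p%:A q%:A r%:A t%:A => u v w z.
  have -> : (u + v * Y) * (w + z * Y) = u * w + v * z * (Y * Y) + (u * z + v * w) * Y.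
    by ring.
  by rewrite YZ2_sqr mulr1.
rewrite !sgn_evalE; case: b; rewrite /= ?expr1 ?expr0; ring.
Qed.

HB.instance Definition _ b := GRing.isZmodMorphism.Build _ _ (sgn_eval b) (sgn_eval_zmod b).
HB.instance Definition _ b := GRing.isMonoidMorphism.Build _ _ (sgn_eval b) (sgn_eval_monoid b).

Lemma sgn_eval_alg b (a : R) : sgn_eval b a%:A = a.
Proof.
have -> : (a%:A : A) = a%:A + 0%:A * Y by rewrite scale0r mul0r addr0.
by rewrite sgn_evalE mulr0 addr0.
Qed.

Lemma sgn_eval_Y b : sgn_eval b Y = (-1) ^+ b.
Proof.
have -> : Y = 0%:A + 1%:A * Y by rewrite scale0r scale1r mul1r add0r.
by rewrite sgn_evalE mulr1 add0r.
Qed.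

Section SupportedPolynomials.
Variable J : pred nat.

Definition supp_pred : {pred {poly R}} :=
  fun p => all (fun i => J i || (p`_i == 0)) (iota 0 (size p)).

Lemma supp_predP (p : {poly R}) : p \in supp_pred <-> forall i, ~~ J i -> p`_i = 0.
Proof.
split=> [/allP pJ i nJ|pJ]; last first.
  by apply/allP => i _; case: (boolP (J i)) => //= /pJ ->.
have [ip|ip] := ltnP i (size p); last by rewrite nth_default.
have := pJ i; rewrite mem_iota /= ip (negbTE nJ) => /(_ isT) /eqP //.
Qed.

Fact supp_zmod_closed : zmod_closed supp_pred.
Proof.
split=> [|p q /supp_predP pJ /supp_predP qJ]; apply/supp_predP => i nJ.
  by rewrite coef0.
by rewrite coefB pJ // qJ // subr0.
Qed.

HB.instance Definition _ := GRing.isZmodClosed.Build {poly R} supp_pred supp_zmod_closed.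

Record supp_poly := SuppPoly { supp_val :> {poly R}; _ : supp_val \in supp_pred }.

HB.instance Definition _ := [isSub for supp_val].
HB.instance Definition _ := [Choice of supp_poly by <:].
HB.instance Definition _ := [SubChoice_isSubZmodule of supp_poly by <:].

Lemma suppZ_subproof (a : R) (p : supp_poly) : a *: (p : {poly R}) \in supp_pred.
Proof.
have /supp_predP pJ := valP p; apply/supp_predP => i /pJ p0.
by rewrite coefZ p0 mulr0.
Qed.

Lemma supp_coef (p : supp_poly) i : ~~ J i -> (p : {poly R})`_i = 0.
Proof. by have /supp_predP := valP p; apply. Qed.
End SupportedPolynomials.

(* The free R-module on J, on which Y acts by the scalar (-1)^b.             *)
Definition sgn_module (b : bool) (J : pred nat) : Type := supp_poly J.

Section SignModule.
Variables (b : bool) (J : pred nat).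
Local Notation P := (sgn_module b J).

HB.instance Definition _ := GRing.Zmodule.on P.

Definition sgn_scale (z : A) (p : P) : P := SuppPoly (suppZ_subproof (sgn_eval b z) p).

Fact sgn_scaleA u v p : sgn_scale u (sgn_scale v p) = sgn_scale (u * v) p.
Proof. by apply: val_inj; rewrite /= rmorphM scalerA. Qed.
Fact sgn_scale1 : left_id 1 sgn_scale.
Proof. by move=> p; apply: val_inj; rewrite /= rmorph1 scale1r. Qed.
Fact sgn_scaleDr : right_distributive sgn_scale +%R.
Proof. by move=> u p q; apply: val_inj; rewrite /= scalerDr. Qed.
Fact sgn_scaleDl p : {morph sgn_scale^~ p : u v / u + v}.
Proof. by move=> u v; apply: val_inj; rewrite /= rmorphD scalerDl. Qed.

HB.instance Definition _ := GRing.Zmodule_isLmodule.Build A P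
  sgn_scaleA sgn_scale1 sgn_scaleDr sgn_scaleDl.

Lemma sgn_valZ (z : A) (p : P) : supp_val (z *: p) = sgn_eval b z *: supp_val p.
Proof. by []. Qed.

Lemma sgn_valD (p q : P) : supp_val (p + q) = supp_val p + supp_val q.
Proof. by []. Qed.

Lemma sgn_val_inj : injective (@supp_val J : P -> {poly R}).
Proof. exact: val_inj. Qed.

Lemma sgn_Y (p : P) : Y *: p = (-1) ^+ b *: p.
Proof.
apply: sgn_val_inj; rewrite !sgn_valZ sgn_eval_Y; congr (_ *: _).
by rewrite rmorphXn rmorphN1.
Qed.

Definition sgn_basis (n : nat) : P :=
  insubd (0 : supp_poly J) (if J n then 'X^n else 0).

Lemma sgn_basisE n : J n -> supp_val (sgn_basis n) = 'X^n.
Proof.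
move=> Jn; rewrite /sgn_basis Jn -[LHS]/(val (insubd _ _)) insubdK //.
apply/supp_predP => i; rewrite coefXn; case: eqP => // ->; by rewrite Jn.
Qed.

Lemma sgn_expand (p : P) : p = R_lincomb sgn_basis (supp_val p).
Proof.
apply: sgn_val_inj; rewrite (R_lincombE _ (leqnn _)).
rewrite (big_morph _ sgn_valD (erefl : supp_val (0 : P) = 0)).
rewrite -[LHS]coefK poly_def; apply: eq_bigr => i _.
rewrite sgn_valZ sgn_eval_alg; have [Ji|nJi] := boolP (J i).
  by rewrite sgn_basisE.
by rewrite supp_coef // !scale0r.
Qed.

Lemma sgn_coordinatized : coordinatized P.
Proof.
exists unit, (fun _ p => supp_val p), (fun _ => sgn_basis); split.
  by move=> _ a x y; rewrite sgn_valD sgn_valZ sgn_eval_alg.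
by move=> p; rewrite big_const card_unit /= addr0; exact: sgn_expand.
Qed.

Lemma sgn_projective : projective (resR P).
Proof.
move=> U V p f /choice [h hK].
have gL : linear (fun x : resR P => lincomb (fun n => h (f (sgn_basis n))) (supp_val (x : P))).
  move=> a x y; rewrite -linearP; congr lincomb.
  by rewrite -[LHS]/(supp_val (a%:A *: (x : P) + (y : P))) sgn_valD sgn_valZ sgn_eval_alg.
exists (mk_linear gL) => x /=.
rewrite /lincomb linear_sum [in RHS](sgn_expand x).
rewrite /R_lincomb /lincomb linear_sum; apply: eq_bigr => i _.
by rewrite !linearZ hK.
Qed.

Lemma sgn_countable : countable_type R -> countable_type P.
Proof. by move=> /countable_type_poly; apply: countable_type_inj; exact: sgn_val_inj. Qed.
End SignModule.
End SignModules.

(** * Coordinates *)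

Section FreeGroupRingModule.
Variable R : comNzRingType.
Local Notation A := (RZ2 R).
Local Notation Y := (YZ2 R).
Local Notation L := (dsum_inf (RZ2 R)).

Lemma RZ2_coefD (x y : A) i : (x + y)`_i = x`_i + y`_i.
Proof. by rewrite -[LHS]/(((x : {poly R}) + (y : {poly R}))`_i) coefD. Qed.

Lemma RZ2_coefZ (a : R) (x : A) i : (a%:A * x : A)`_i = a * x`_i.
Proof.
by rewrite -scalerAl mul1r -[LHS]/((a *: (x : {poly R}))`_i) coefZ.
Qed.

Lemma dsum_inf_coordinatized : coordinatized (L : lmodType A).
Proof.
pose c (i : bool) (l : L) : {poly R} := \poly_(n < size l) ((l : {poly A})`_n)`_i.
have cE i l n : (c i l)`_n = ((l : {poly A})`_n)`_i.
  rewrite coef_poly; case: ltnP => // ln; rewrite [(l : {poly A})`_n]nth_default //.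
  by rewrite -[LHS]/(0 : R) -[RHS]/((0 : {poly R})`_i) coef0.
exists bool, c, (fun (i : bool) n => Y ^+ i *: ('X^n : {poly A}) : L); split.
  move=> i a x y; apply/polyP => n; rewrite coefD coefZ !cE coefD coefZ.
  by rewrite RZ2_coefD RZ2_coefZ.
move=> l; rewrite big_bool /=.
rewrite !(@R_lincombE _ _ _ (size (l : {poly A}))) ?size_poly // -big_split /=.
rewrite -[LHS]coefK poly_def; apply: eq_bigr => n _.
by rewrite !cE expr0 expr1 scale1r scalerA -scalerDl [_ * Y + _]addrC -RZ2_XE.
Qed.

Lemma RZ2_tate (b : bool) (z : A) : ((-1) ^+ b * Y) * z = z ->
  z = (z`_0)%:A + ((-1) ^+ b * Y) * (z`_0)%:A.
Proof.
move=> ez; rewrite [LHS]RZ2_XE; congr (_ + _).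
have algM (u v : R) : (u * v)%:A = u%:A * v%:A :> A by rewrite -scalerAl mul1r scalerA.
have sgnA : (-1) ^+ b = ((-1) ^+ b)%:A :> A.
  by case: b {ez}; rewrite ?expr0 ?expr1 ?scaleN1r ?scale1r.
have ez1 : (((-1) ^+ b * Y) * z)`_1 = (-1) ^+ b * z`_0.
  rewrite [in LHS](RZ2_XE z); move: (z`_0) (z`_1) => p q.
  have -> : (-1) ^+ b * Y * (p%:A + q%:A * Y) =
      ((-1) ^+ b * q)%:A + ((-1) ^+ b * p)%:A * Y :> A.
    rewrite !algM -sgnA; move: ((-1) ^+ b : A) p%:A q%:A => u v w.
    have -> : u * Y * (v + w * Y) = u * w * (Y * Y) + u * v * Y by ring.
    by rewrite YZ2_sqr mulr1.
  by rewrite RZ2_coef1.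
by rewrite -ez ez1 ez algM -sgnA mulrAC.
Qed.

(** Free A-modules have trivial Tate cohomology, so a summand L can be added to the source to reach
    surjectivity without affecting Tate groups. *)
Lemma dsum_inf_tate (b : bool) (l : L) : ((-1) ^+ b * Y) *: l = l ->
  exists l', l = l' + ((-1) ^+ b * Y) *: l'.
Proof.
move=> el; exists (\poly_(n < size (l : {poly A})) (((l : {poly A})`_n)`_0)%:A).
apply/polyP => n; rewrite coefD coefZ coef_poly; case: ltnP => nl.
  apply: RZ2_tate; have /(congr1 (fun p : {poly A} => p`_n)) := el.
  by rewrite coefZ.
by rewrite nth_default // mulr0 addr0.
Qed.
End FreeGroupRingModule.

Section Coordinates.
Variable R : comNzRingType.
Local Notation A := (RZ2 R).

Lemma coordinatized_prod (U V : lmodType A) :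
  coordinatized U -> coordinatized V -> coordinatized (U * V : lmodType A)%type.
Proof.
move=> [I [c [m [cL mE]]]] [I' [c' [m' [cL' mE']]]].
exists (I + I')%type,
  (fun i x => match i with inl i => c i x.1 | inr i => c' i x.2 end),
  (fun i n => match i with inl i => (m i n, 0) | inr i => (0, m' i n) end); split.
  by move=> [i|i] a x y /=; rewrite ?cL ?cL'.
move=> [x y]; rewrite big_sumType /=.
have pr1 i p : R_lincomb (fun n => (m i n, 0 : V)) p = (R_lincomb (m i) p, 0).
  rewrite !(R_lincombE _ (leqnn _)); elim/big_rec2: _ => // n u v _ ->.
  by rewrite -[LHS]/(_, _) /= scaler0 addr0.
have pr2 i p : R_lincomb (fun n => (0 : U, m' i n)) p = (0, R_lincomb (m' i) p).
  rewrite !(R_lincombE _ (leqnn _)); elim/big_rec2: _ => // n u v _ ->.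
  by rewrite -[LHS]/(_, _) /= scaler0 addr0.
rewrite (eq_bigr _ (fun i _ => pr1 i (c i x))) (eq_bigr _ (fun i _ => pr2 i (c' i y))).
have s1 (F : I -> U) : \sum_i (F i, 0 : V) = (\sum_i F i, 0).
  by elim/big_rec2: _ => // i u v _ ->; rewrite -[LHS]/(_, _) /= addr0.
have s2 (F : I' -> V) : \sum_i (0 : U, F i) = (0, \sum_i F i).
  by elim/big_rec2: _ => // i u v _ ->; rewrite -[LHS]/(_, _) /= addr0.
by rewrite s1 s2 -mE -mE' -[RHS]/(_, _) /= addr0 add0r.
Qed.

Lemma projective_coordinatized (M : lmodType A) :
  countable_type M -> projective (resR M) -> coordinatized M.
Proof.
move=> Mc Mp; have [v vP] := countable_enum (0 : M) Mc.
have [|g gE] := Mp {poly R} (resR M) (lincomb (v : nat -> resR M)) idfun.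
  by move=> x; have [n <-] := vP x; exists 'X^n; exact: lincombXn.
exists unit, (fun _ x => g x), (fun _ => v); split.
  by move=> _ a x y; rewrite -[RHS]linearP.
by move=> x; rewrite big_const card_unit /= addr0 -[LHS](gE x).
Qed.

(** On the component at g, R acts through [act g], so coordinates there are only semilinear;
    applying the inverse automorphism to the coefficients makes them linear. *)
Lemma twsum_coordinatized (G : finType) (act inv : G -> {rmorphism R -> R}) (M : lmodType A) :
  (forall g, cancel (act g) (inv g)) -> (forall g, cancel (inv g) (act g)) ->
  coordinatized M -> coordinatized (twsum act M).
Proof.
move=> actK invK [I [c [m [cL mE]]]].
pose delta g (x : M) : twsum act M := [ffun h => if h == g then x else 0].
exists (G * I)%type,
  (fun gi (f : twsum act M) => map_poly (inv gi.1) (c gi.2 ((f : {ffun G -> M}) gi.1))),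
  (fun gi n => delta gi.1 (m gi.2 n)); split.
  move=> [g i] a x y /=; rewrite !ffunE twistZ2_alg cL.
  by rewrite rmorphD /= map_polyZ actK.
move=> f; apply/ffunP => h; rewrite -(pair_bigA _ (fun g i =>
   R_lincomb (fun n => delta g (m i n)) (map_poly (inv g) (c i ((f : {ffun G -> M}) g))))) /=.
rewrite sum_ffunE (bigD1 h) //= [X in _ = _ + X]big1 => [|g gh]; last first.
  rewrite sum_ffunE big1 // => i _; rewrite (R_lincombE _ (leqnn _)) sum_ffunE.
  by rewrite big1 // => n _; rewrite !ffunE eq_sym (negbTE gh) scaler0.
rewrite addr0 sum_ffunE [LHS]mE; apply: eq_bigr => i _.
rewrite !(@R_lincombE _ _ _ (size (c i ((f : {ffun G -> M}) h)))) ?size_poly // sum_ffunE.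
by apply: eq_bigr => n _; rewrite !ffunE eqxx coef_map twistZ2_alg /= invK.
Qed.

End Coordinates.

(** * The Tate groups of the twisted sum *)

(** Modulo norms, all e-invariants of E come from X, where e acts trivially and norms are doubles.
    So only the map from X/2X to the Tate group of N has to be examined. *)
Lemma tate_of_summand (A : comNzRingType) (X E N : lmodType A) (pi : {linear E -> N})
    (io : {linear X -> E}) (e : A) : e * e = 1 ->
  (forall x : X, e *: x = x) ->
  (forall x : E, e *: x = x -> exists p u, x = io p + (u + e *: u)) ->
  (forall p w, pi (io p) = w + e *: w -> exists u, p = u *+ 2) ->
  (forall w, e *: w = w -> exists p v, w = pi (io p) + (v + e *: v)) ->
  tate_inj pi e /\ tate_surj pi e.
Proof.
move=> ee eX decE inj surj; split=> [x ex w Dw|w ew].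
  have [p [u Dx]] := decE x ex.
  have [|q Dq] := inj p (w - pi u).
    have -> : pi (io p) = pi x - pi (u + e *: u).
      by rewrite Dx linearD addrK.
    by rewrite Dw linearD linearZ scalerBr; abel.
  have eio : e *: io q = io q by rewrite -linearZ /= eX.
  by exists (io q + u); rewrite Dx Dq mulr2n linearD scalerDr eio; abel.
have [p [v ->]] := surj w ew; exists (io p), v; split=> //.
by rewrite -linearZ /= eX.
Qed.

Section GaloisTwist.
Variables (R : comNzRingType) (G : finGroupType) (act : G -> {rmorphism R -> R}).
Hypotheses
  (actM : forall g h x, act (g * h)%g x = act h (act g x))
  (act1 : forall x, act 1%g x = x).
Hypothesis intr_eq0R : forall c : int, c%:~R = 0 :> R -> c = 0.
Hypothesis torsion_free2 : forall x : R, x *+ 2 = 0 -> x = 0.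
Variables (s : seq (R * R)) (tr : R -> int).
Hypothesis galois_s : forall g, exists r,
  \sum_(t <- s) t.1 * act g t.2 = (g == 1%g)%:R + 2 * r.
Hypothesis trE : forall a, (tr a)%:~R = \sum_g act g a.

Local Notation A := (RZ2 R).
Local Notation Y := (YZ2 R).
Local Notation L := (dsum_inf (RZ2 R)).

Lemma act_invK g : cancel (act g) (act g^-1%g).
Proof. by move=> x; rewrite -actM mulgV act1. Qed.

Lemma inv_actK g : cancel (act g^-1%g) (act g).
Proof. by move=> x; rewrite -actM mulVg act1. Qed.

Lemma tr0 : tr 0 = 0.
Proof. by apply: intr_eq0R; rewrite trE big1 // => g _; rewrite rmorph0. Qed.

Lemma galois_delta g h : even_elt ((g == h)%:R - \sum_(t <- s) act h t.1 * act g t.2).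
Proof.
have [r Dr] := galois_s (g * h^-1)%g; exists (- act h r).
have /(congr1 (act h)) := Dr.
rewrite rmorph_sum rmorphD rmorphM !rmorph_nat /= -eq_mulgV1.
rewrite (eq_bigr (fun t => act h t.1 * act g t.2)) => [->|t _]; first by ring.
by rewrite rmorphM /= -actM mulgVK.
Qed.

Let ev := @even_elt R.
Let evP : sub_closed ev := @even_elt_closed R.

Let sum_delta (a : R) (F : G -> R) :
  (forall g, ev ((g == 1%g)%:R - F g)) -> ev (a - \sum_g act g a * F g).
Proof.
move=> Fg; have -> : a = \sum_g act g a * (g == 1%g)%:R.
  rewrite (bigD1 1%g) //= eqxx mulr1 act1 big1 ?addr0 // => g /negbTE ->.
  by rewrite mulr0.
(* The preceding rewriting has also expanded [a] inside the second sum; this folds it back. *)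
rewrite [X in _ - X](_ : _ = \sum_g act g a * F g); last first.
  apply: eq_bigr => g _; congr (act g _ * _).
  rewrite (bigD1 1%g) //= eqxx mulr1 act1 big1 ?addr0 // => h /negbTE ->.
  by rewrite mulr0.
rewrite -sumrB; apply: (sub_closed_sum evP) => g; rewrite -mulrBr.
by have [r ->] := Fg g; exists (act g a * r); rewrite mulrnAr.
Qed.

(** Expanding the trace, the sum is that of g(a) times sum_t g(t.1) t.2 over g, and the inner sum is
    [g = 1] modulo 2. *)
Lemma trace_dual1 a : ev (a - \sum_(t <- s) (tr (a * t.1))%:~R * t.2).
Proof.
rewrite (eq_bigr (fun t => \sum_g act g a * (act g t.1 * t.2))) => [|t _].
  rewrite exchange_big /=; under eq_bigr => g _ do rewrite -big_distrr /=.
  apply: (@sum_delta a (fun g => \sum_(t <- s) act g t.1 * t.2)) => g.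
  have := galois_delta 1%g g; rewrite eq_sym.
  by under eq_bigr => t _ do rewrite act1.
rewrite trE big_distrl; apply: eq_bigr => g _.
by rewrite rmorphM mulrA.
Qed.

Lemma trace_dual2 a : ev (a - \sum_(t <- s) (tr (a * t.2))%:~R * t.1).
Proof.
rewrite (eq_bigr (fun t => \sum_g act g a * (act g t.2 * t.1))) => [|t _].
  rewrite exchange_big /=; under eq_bigr => g _ do rewrite -big_distrr /=.
  apply: (@sum_delta a (fun g => \sum_(t <- s) act g t.2 * t.1)) => g.
  have := galois_delta g 1%g.
  by under eq_bigr => t _ do rewrite act1 mulrC.
rewrite trE big_distrl; apply: eq_bigr => g _.
by rewrite rmorphM mulrA.
Qed.

Lemma trace_dual3 : ev (\sum_(t <- s) t.1 * t.2 - 1).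
Proof.
have := galois_delta 1%g 1%g; rewrite eqxx => /(sub_closedN evP); rewrite opprB.
by under eq_bigr => t _ do rewrite !act1.
Qed.

Section SignPart.
Variables (M : lmodType A) (Mcount : countable_type M) (b : bool).
Local Notation N := (twsum act M).
Local Notation e := ((-1) ^+ b * Y : A).

Lemma twist_sgnY g : twistZ2 (act g) e = e.
Proof. by rewrite rmorphM rmorphXn rmorphN rmorph1 /= twistZ2_Y. Qed.

Lemma sgn_module_e J (p : sgn_module R b J) : e *: p = p.
Proof. by rewrite -scalerA sgn_Y scalerA -exprMn mulrNN mulr1 expr1n scale1r. Qed.

(** J indexes an F_2-basis of the Tate group V of M for e, and the n-th generator goes to the
    constant family v_n in M[G]. By Galois descent this identifies the reduction modulo 2 of the
    free module with V[G], the Tate group of M[G]. *)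
Lemma sgn_basis_map : exists (J : pred nat) (f : {linear sgn_module R b J -> N}),
  (forall p w, f p = w + e *: w -> exists u, p = u *+ 2) /\
  (forall w, e *: w = w -> exists p v, w = f p + (v + e *: v)).
Proof.
have [u0 u0P] := countable_enum (0 : M) Mcount.
(* Elements that e does not fix are replaced by 0, so that [v] enumerates exactly the invariants. *)
pose v n := if e *: u0 n == u0 n then u0 n else 0.
have ve n : e *: v n = v n.
  by rewrite /v; case: eqP => // _; rewrite scaler0.
have vP x : e *: x = x -> exists n, v n = x.
  by move=> ex; have [n Dn] := u0P x; exists n; rewrite /v Dn ex eqxx.
pose B (x : M) := exists w, x = w + e *: w.
have BP : sub_closed B.
  split=> [|_ _ [x ->] [y ->]]; first by exists 0; rewrite scaler0 addr0.
  by exists (x - y); rewrite scalerBr; abel.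
have BZ (a : A) x : B x -> B (a *: x).
  move=> [w ->]; exists (a *: w).
  by rewrite scalerDr [a *: (e *: w)]scalerA mulrC -scalerA.
have v2 n : B (v n *+ 2) by exists (v n); rewrite ve.
have [J [Jspan Jind]] := F2_basis BP v2.
have ey (x : M) : e *: x = x -> Y *: x = (-1) ^+ b *: x.
  by move=> ex; rewrite -[in RHS]ex scalerA mulrA -exprMn mulrNN mulr1 expr1n mul1r.
pose f0 (p : sgn_module R b J) : N :=
  [ffun g => R_lincomb v (map_poly (act g) (supp_val p))].
have f0E p g N0 : (size (supp_val p) <= N0)%N ->
    f0 p g = \sum_(n < N0) (act g (supp_val p)`_n)%:A *: v n.
  move=> pN; rewrite ffunE (@R_lincombE _ _ _ N0) ?(leq_trans (size_poly _ _)) //.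
  by apply: eq_bigr => n _; rewrite coef_map.
have efix (p : {poly R}) : e *: R_lincomb v p = R_lincomb v p.
  rewrite (R_lincombE _ (leqnn _)) scaler_sumr; apply: eq_bigr => n _.
  by rewrite scalerA [e * _]mulrC -scalerA ve.
have fL : linear f0.
  apply: R_linear_A => [a x y|x]; apply/ffunP => g.
    rewrite !ffunE twistZ2_alg sgn_valD sgn_valZ sgn_eval_alg rmorphD /= map_polyZ.
    by rewrite R_lincombP.
  rewrite !ffunE twistZ2_Y sgn_valZ sgn_eval_Y map_polyZ R_lincombZ ey ?efix //.
  rewrite rmorphXn rmorphN1; congr (_ *: _).
  by case: b; rewrite ?expr0 ?expr1 ?scaleN1r ?scale1r.
exists J, (mk_linear fL); split=> [p w Dw|w ew].
  have pg g : B (R_lincomb v (map_poly (act g) (supp_val p))).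
    have /(congr1 (fun u : N => (u : {ffun G -> M}) g)) := Dw.
    by rewrite /= !ffunE twist_sgnY => ->; exists ((w : {ffun G -> M}) g).
  (* Weighting the relation at g by g(t) and summing over g gives an integer relation between the
     v_n with coefficients tr(p_n t), so these are even by independence. By [trace_dual1] then p_n
     itself is even. *)
  have tr_even t n : exists d : int, tr ((supp_val p)`_n * t) = d *+ 2.
    pose c := \poly_(n < size (supp_val p)) tr ((supp_val p)`_n * t).
    have cE i : c`_i = tr ((supp_val p)`_i * t).
      rewrite coef_poly; case: ltnP => // /(nth_default 0) ->.
      by rewrite mul0r tr0.
    have [||d Dc] := Jind c.
    - by move=> i nJ; rewrite cE supp_coef // mul0r tr0.
    - rewrite (icombE v (size_poly _ _)).
      rewrite (eq_bigr (fun n : 'I_(size (supp_val p)) => \sum_g (act g t)%:A *: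
          ((act g (supp_val p)`_n)%:A *: v n))) => [|i _]; last first.
        rewrite cE -scale_alg_intr trE scale_alg_sum; apply: eq_bigr => g _.
        by rewrite -scale_algM rmorphM [act g t * _]mulrC.
      rewrite exchange_big /=; apply: (sub_closed_sum BP) => g.
      rewrite -scaler_sumr; apply: BZ; have := pg g.
      rewrite (@R_lincombE _ _ _ (size (supp_val p))) ?size_poly //.
      by under eq_bigr => i _ do rewrite coef_map.
    by exists d`_n; rewrite -cE Dc coefMn.
  have /choice [h hP] : forall n, exists r, (supp_val p)`_n = r *+ 2.
    move=> n; have evp := trace_dual1 (supp_val p)`_n.
    rewrite -[(supp_val p)`_n](subrK (\sum_(t <- s) (tr ((supp_val p)`_n * t.1))%:~R * t.2)).
    apply: (sub_closedD evP evp); apply: (sub_closed_sum evP) => t.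
    by have [d ->] := tr_even t.1 n; exists (d%:~R * t.2); rewrite rmorphMn mulrnAl.
  have uJ : \poly_(n < size (supp_val p)) h n \in @supp_pred R J.
    apply/supp_predP => i nJ; rewrite coef_poly; case: ifP => // _.
    by apply: torsion_free2; rewrite -hP supp_coef.
  exists (SuppPoly uJ); apply: sgn_val_inj; rewrite mulr2n sgn_valD /=.
  apply/polyP => n; rewrite coefD coef_poly hP; case: ltnP => // /(nth_default 0).
  by rewrite hP => ->; rewrite addr0.
pose Im (x : N) := exists p v, x = f0 p + (v + e *: v).
have ImP : sub_closed Im.
  split=> [|_ _ [p [x ->]] [q [y ->]]].
    by exists 0, 0; rewrite scaler0 !addr0 -[f0]/(mk_linear fL : _ -> _) linear0.
  exists (p - q), (x - y); rewrite -[f0]/(mk_linear fL : _ -> _) linearB.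
  by rewrite scalerBr; abel.
have ImB (x : N) : (forall g, B ((x : {ffun G -> M}) g)) -> Im x.
  move=> /choice [h hP]; exists 0, ([ffun g => h g] : N).
  rewrite -[f0]/(mk_linear fL : _ -> _) linear0 add0r.
  by apply/ffunP => g; rewrite !ffunE twist_sgnY.
pose kap (a : R) (x : M) : N := [ffun g => (act g a)%:A *: x].
have Im_kap a x : e *: x = x -> Im (kap a x).
  move=> /vP [n <-]; have [c cJ cB] := Jspan n.
  have pJ : \poly_(i < size c) (a * (c`_i)%:~R) \in @supp_pred R J.
    by apply/supp_predP => i /cJ ci; rewrite coef_poly ci mulr0 if_same.
  rewrite -[kap a _](subrK (f0 (SuppPoly pJ))); apply: (sub_closedD ImP); last first.
    by exists (SuppPoly pJ), 0; rewrite scaler0 !addr0.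
  apply: ImB => g; rewrite ffunE [(- _ : {ffun G -> M}) g]ffunE /kap ffunE.
  rewrite (@f0E _ _ (size c)) ?size_poly //.
  rewrite (_ : \sum_(i < _) _ = (act g a)%:A *: icomb v c).
    by rewrite -scalerBr; exact: BZ.
  rewrite /icomb scaler_sumr; apply: eq_bigr => i _ /=.
  by rewrite coef_poly ltn_ord rmorphM rmorph_int scale_algM scale_alg_intr.
have wE : w = \sum_h ([ffun g => if g == h then (w : {ffun G -> M}) h else 0] : N).
  apply/ffunP => g; rewrite sum_ffunE (bigD1 g) //= ffunE eqxx big1 ?addr0 // => h gh.
  by rewrite ffunE eq_sym (negbTE gh).
rewrite wE; apply: (sub_closed_sum ImP) => h.
have ewh : e *: (w : {ffun G -> M}) h = (w : {ffun G -> M}) h.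
  by rewrite -[in RHS]ew ffunE twist_sgnY.
move: ((w : {ffun G -> M}) h) ewh => x ex.
set dx : N := finfun _.
(* The family [dx], concentrated at h, agrees modulo norms with sum_t h(t.1) g(t.2) x by
   [galois_delta], and this is a sum of families g |-> g(a) x', which [Im_kap] covers. *)
rewrite -[dx](subrK (\sum_(t <- s) kap t.2 ((act h t.1)%:A *: x))).
apply: (sub_closedD ImP); last first.
  apply: (sub_closed_sum ImP) => t; apply: Im_kap.
  by rewrite scalerA [e * _]mulrC -scalerA ex.
apply: ImB => g; rewrite ffunE [(- _ : {ffun G -> M}) g]ffunE sum_ffunE ffunE.
have [r Dr] := galois_delta g h.
rewrite (_ : _ - _ = (r *+ 2)%:A *: x).
  exists (r%:A *: x); rewrite scalerA [e * _]mulrC -scalerA ex.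
  by rewrite mulr2n !scalerDl.
rewrite -Dr scale_algB scale_alg_sum; congr (_ - _).
  by case: eqP => _; rewrite ?scale1r // !scale0r.
by apply: eq_bigr => t _; rewrite ffunE -scale_algM mulrC.
Qed.
End SignPart.
End GaloisTwist.

(** * The decomposition *)

Section Decomposition.
Variables (R : comNzRingType) (G : finGroupType) (act : G -> {rmorphism R -> R}).
Hypotheses
  (actM : forall g h x, act (g * h)%g x = act h (act g x))
  (act1 : forall x, act 1%g x = x).
Hypothesis Rcount : countable_type R.
Hypothesis intr_eq0R : forall c : int, c%:~R = 0 :> R -> c = 0.
Hypothesis torsion_free2 : forall x : R, x *+ 2 = 0 -> x = 0.
Hypothesis fixedR : forall x, (forall g, act g x = x) -> exists c : int, x = c%:~R.
Variables (s : seq (R * R)).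
Hypothesis galois_s : forall g, exists r,
  \sum_(t <- s) t.1 * act g t.2 = (g == 1%g)%:R + 2 * r.

Local Notation A := (RZ2 R).
Local Notation Y := (YZ2 R).
Local Notation L := (dsum_inf (RZ2 R)).
Variables (M : lmodType A).
Hypotheses (Mcount : countable_type M) (Mproj : projective (resR M)).
Local Notation N := (twsum act M).

(** The map P0 + P1 + L -> M[G] given by the two sign maps and an enumeration of M[G] is surjective
    and an isomorphism on both Tate groups, so [stable_equivalence] applies. *)
Lemma twsum_decomposition : exists (J0 J1 : pred nat),
  mod_iso (N * L)%type (sgn_module R false J0 * sgn_module R true J1 * L)%type.
Proof.
have /choice [tr trE] : forall a, exists c : int, c%:~R = \sum_g act g a.
  move=> a; have [|c ->] := fixedR (x := \sum_g act g a); last by exists c.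
  move=> k; rewrite rmorph_sum [RHS](reindex_inj (mulIg k)) /=.
  by apply: eq_bigr => h _; rewrite actM.
have d1 := trace_dual1 actM act1 galois_s trE.
have d2 := trace_dual2 actM act1 galois_s trE.
have d3 := trace_dual3 actM act1 galois_s.
have [J0 [f0 [inj0 surj0]]] :=
  @sgn_basis_map R G act actM act1 intr_eq0R torsion_free2 s tr galois_s trE M Mcount false.
have [J1 [f1 [inj1 surj1]]] :=
  @sgn_basis_map R G act actM act1 intr_eq0R torsion_free2 s tr galois_s trE M Mcount true.
exists J0, J1; set P0 := sgn_module R false J0; set P1 := sgn_module R true J1.
pose E : lmodType A := (P0 * P1 * L)%type.
have Acount : countable_type A.
  by apply: countable_type_inj (countable_type_poly Rcount); exact: val_inj.
have Ncount : countable_type N by exact: countable_type_ffun.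
have [v vP] := countable_enum (0 : N) Ncount.
pose lam : {linear L -> N} := lincomb v.
have piL : linear (fun x : E => f0 x.1.1 + f1 x.1.2 + lam x.2).
  by move=> a x y; rewrite /= !linearP !scalerDr; abel.
have poly_tf (p : {poly R}) : p *+ 2 = 0 -> p = 0.
  move=> p2; apply/polyP => n; rewrite coef0; apply: torsion_free2.
  by rewrite -coefMn p2 coef0.
have A_tf (z : A) : z *+ 2 = 0 -> z = 0.
  by move=> /(congr1 val); rewrite raddfMn => /poly_tf z0; apply: val_inj; rewrite z0.
have P_tf b J (p : sgn_module R b J) : p *+ 2 = 0 -> p = 0.
  move=> /(congr1 (@supp_val R J)); rewrite mulr2n sgn_valD -mulr2n => /poly_tf p0.
  by apply: sgn_val_inj.
have L_tf (l : L) : l *+ 2 = 0 -> l = 0.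
  move=> l2; apply/polyP => n; rewrite coef0; apply: A_tf.
  by rewrite -coefMn l2 coef0.
have e0 : (-1) ^+ false * Y = Y :> A by rewrite expr0 mul1r.
have e1 : (-1) ^+ true * Y = - Y :> A by rewrite expr1 mulN1r.
have Y0 (p : P0) : Y *: p = p by rewrite -e0; exact: sgn_module_e.
have Y1 (p : P1) : - Y *: p = p by rewrite -e1; exact: sgn_module_e.
have neg2 (V : zmodType) (x : V) : (x *+ 2 = 0 -> x = 0) -> - x = x -> x = 0.
  by move=> tf ex; apply: tf; rewrite mulr2n -{1}ex addNr.
have io0L : linear (fun p : P0 => (p, 0, 0) : E).
  by move=> a x y; rewrite -[RHS]/(_, _, _) /= !scaler0 !addr0.
have io1L : linear (fun p : P1 => (0, p, 0) : E).
  by move=> a x y; rewrite -[RHS]/(_, _, _) /= !scaler0 !addr0.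
(* Only P0 matters for Y: an invariant element of P1 is its own opposite, hence 0, and an invariant
   element of L is a norm. For -Y the roles of P0 and P1 are exchanged. *)
have [t0 u0] : tate_inj (mk_linear piL) Y /\ tate_surj (mk_linear piL) Y.
  apply: (tate_of_summand (io := mk_linear io0L)) => //.
  - exact: YZ2_sqr.
  - move=> [[p q] l] ex; have := congr1 (fun x : E => x.1.2) ex.
    have := congr1 (fun x : E => x.2) ex; rewrite /= => el eq.
    have [l' Dl] : exists l', l = l' + Y *: l'.
      by have [|l' Dl] := @dsum_inf_tate R false l; rewrite ?e0 //; exists l'; rewrite -e0.
    exists p, (0, 0, l'); rewrite -[RHS]/(_, _, _) /= !scaler0 !addr0 add0r -Dl.
    by have -> : q = 0 by apply: (neg2 _ q (@P_tf _ _ _)); rewrite -[in LHS]eq -scaleNr Y1.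
  - by move=> p w /=; rewrite !linear0 !addr0 -e0; exact: inj0.
  move=> w; rewrite -e0 => /surj0 [p [v' ->]]; exists p, v'.
  by rewrite /= !linear0 !addr0.
have [t1 u1] : tate_inj (mk_linear piL) (- Y) /\ tate_surj (mk_linear piL) (- Y).
  apply: (tate_of_summand (io := mk_linear io1L)) => //.
  - by rewrite mulrNN YZ2_sqr.
  - move=> [[p q] l] ex; have := congr1 (fun x : E => x.1.1) ex.
    have := congr1 (fun x : E => x.2) ex; rewrite /= => el ep.
    have [l' Dl] : exists l', l = l' + (- Y) *: l'.
      by have [|l' Dl] := @dsum_inf_tate R true l; rewrite ?e1 //; exists l'; rewrite -e1.
    exists q, (0, 0, l'); rewrite -[RHS]/(_, _, _) /= !scaler0 !addr0 !add0r -Dl.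
    have -> // : p = 0; apply: (neg2 _ p (@P_tf _ _ _)).
    by rewrite -[in RHS]ep scaleNr Y0.
  - by move=> p w /=; rewrite !linear0 add0r addr0 -e1; exact: inj1.
  move=> w; rewrite -e1 => /surj1 [p [v' ->]]; exists p, v'.
  by rewrite /= !linear0 add0r addr0.
(* The swindle with Q = L; it absorbs the copy of L contained in E. *)
have LL : mod_iso (L * L)%type L by apply: (@swindle _ _ idfun idfun).
suff EL : mod_iso (N * L)%type (E * L)%type.
  apply: (mod_iso_trans EL); apply: (mod_iso_trans (mod_isoA _ _ _)).
  by apply: mod_iso_prod; first exact: mod_iso_refl.
apply: (stable_equivalence _ _ _ _ _ t0 u0 t1 u1 d1 d2 d3).
- move=> x; have [n <-] := vP x; exists (0, 0, 'X^n) => /=.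
  by rewrite !linear0 !add0r; exact: lincombXn.
- apply: countable_type_prod; last exact: countable_type_poly.
  by apply: countable_type_prod; exact: sgn_countable.
- apply: coordinatized_prod; last exact: dsum_inf_coordinatized.
  by apply: coordinatized_prod; exact: sgn_coordinatized.
- apply: (twsum_coordinatized (inv := fun g => act g^-1%g)).
  + exact: (@act_invK R G act actM act1).
  + exact: (@inv_actK R G act actM act1).
  exact: projective_coordinatized.
move=> [[p q] l] x2.
have /P_tf p0 : p *+ 2 = 0 by rewrite mulr2n -[RHS]/((0 : E).1.1) -x2 mulr2n.
have /P_tf q0 : q *+ 2 = 0 by rewrite mulr2n -[RHS]/((0 : E).1.2) -x2 mulr2n.
have /L_tf l0 : l *+ 2 = 0 by rewrite mulr2n -[RHS]/((0 : E).2) -x2 mulr2n.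
by rewrite p0 q0 l0.
Qed.
End Decomposition.

Theorem theoremA7
  (K : splittingFieldType rat) (iota : {rmorphism K -> algC})
  (unram : unramified_at_2 (ringOfIntegers iota))
  (M : lmodType (RZ2 (ringOfIntegers iota)))
  (M_count : countable_type M)
  (M_proj : projective (resR M)) :
  exists (Pp Pm : lmodType (RZ2 (ringOfIntegers iota))),
    [/\ countable_type Pp /\ countable_type Pm,
        projective (resR Pp) /\ projective (resR Pm),
        forall x : Pp, YZ2 _ *: x = x,
        forall x : Pm, YZ2 _ *: x = - x &
        mod_iso
          (twsum (@galOK K iota) M * dsum_inf (RZ2 (ringOfIntegers iota)))%type
          (Pp * Pm * dsum_inf (RZ2 (ringOfIntegers iota)))%type].
Proof.
set R := ringOfIntegers iota.
have [s sE] := unramified_galois_coordinates (@galOK_M K iota) (@galOK_1 K iota)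
  (@oint_natr_inj K iota) (@oint_integral_domain K iota) (@oint_integral K iota)
  (@galOK_fixed K iota) (@galOK_faithful K iota) unram.
have Rcount : countable_type R by exact: oint_countable.
have Rtf (x : R) : x *+ 2 = 0 -> x = 0.
  by rewrite -mulr_natl; exact: oint_natr_inj.
have [J0 [J1 iso]] := twsum_decomposition (@galOK_M K iota) (@galOK_1 K iota) Rcount
  (@oint_intr_eq0 K iota) Rtf (@galOK_fixed K iota) sE M_count M_proj.
exists (sgn_module R false J0), (sgn_module R true J1); split=> //.
- by split; exact: sgn_countable.
- by split; exact: sgn_projective.
- by move=> x; rewrite sgn_Y expr0 scale1r.
by move=> x; rewrite sgn_Y expr1 scaleN1r.
Qed.
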